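(* Let $\mathcal C$, $\mathcal J$, $\mathcal R$, $\mathcal K=\mathcal R\mathcal J$ and $\nabla$ be as defined in the context, let $H_0=-\sum_{k=-\infty}^\infty\log(1-q_kr_k)$, and let $X_{(n)}=\mathcal R^n\mathcal J\nabla H_0$ for $n\ge0$. Then the fields $X_{(n)}$ of the hierarchy $((q_k,r_k)^T)_t=X_{(n)}$ are Hamiltonian with respect to both $\mathcal J$ and $\mathcal K$, i.e. bi-Hamiltonian in the following sense: there is a sequence of functionals $H_1,H_2,\dots$ on $\mathcal C$ such that, together with the given $H_0$, the Lenard relations $$X_{(n)}=\mathcal K\nabla H_{n-1}=\mathcal J\nabla H_n$$ hold for all $n\ge1$.
   Context: Phase space. $\mathcal C$ is the space of sequences $(q_k,r_k)^T_{k\in\mathbb Z}$ in $\mathbb C^2$ with $|q_k|,|r_k|\to0$ as $k\to\pm\infty$; potentials are assumed to vanish rapidly (so that all sums below converge) and $1-r_kq_k\ne0$. On the tangent space at $(q,r)^T$ one has the (non-Hermitian) bilinear form $$\langle(a,b)^T,(c,d)^T\rangle=-\sum_{k\in\mathbb Z}(a_kd_k+b_kc_k)(1-q_kr_k)^{-1},$$ and $^*$ denotes the adjoint with respect to it. The functional gradient of a functional $F$ on $\mathcal C$ is $\nabla_kF=-(1-q_kr_k)\,(\delta F/\delta r_k,\ \delta F/\delta q_k)^T$. Let $\mathcal J$ act as $\mathrm{diag}(-i,i)$ at each site and let $\sigma_3=\mathrm{diag}(1,-1)$. In particular $\mathcal J\nabla H_0=i(q_k,-r_k)^T$. Operators.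 For $w=(u_k,v_k)^T_{k\in\mathbb Z}$ put $s_j=\dfrac{q_ju_j-r_jv_j}{1-r_jq_j}$ and $$(Lw)_k=\begin{pmatrix} u_{k-1}-(1-r_kq_k)r_{k-1}\sum_{j\ge k}s_j-r_k\sum_{j\ge k}(q_ju_{j-1}-r_jv_{j+1})\\ v_{k+1}-(1-r_kq_k)q_{k+1}\sum_{j\ge k+1}s_j-q_k\sum_{j\ge k+1}(q_ju_{j-1}-r_jv_{j+1})\end{pmatrix},$$ $$(L^{-1}w)_k=\begin{pmatrix} u_{k+1}+(1-r_kq_k)r_{k+1}\sum_{j\ge k+1}s_j+r_k\sum_{j\ge k+1}(q_ju_{j+1}-r_jv_{j-1})\\ v_{k-1}+(1-r_kq_k)q_{k-1}\sum_{j\ge k}s_j+q_k\sum_{j\ge k}(q_ju_{j+1}-r_jv_{j-1})\end{pmatrix}.$$ Set $\mathcal L_+=L+L^{-1}$ and $\mathcal L_-=\sigma_3\mathcal L_+^*\sigma_3^{-1}$; explicitly, with $t_j=q_j(u_{j+1}-u_{j-1})+r_j(v_{j+1}-v_{j-1})$, $$(\mathcal L_-w)_k=\begin{pmatrix} u_{k+1}+u_{k-1}-(1-r_kq_k)\left[r_{k+1}\sum_{j\le k}s_j-r_{k-1}\sum_{j\le k-1}s_j\right]-r_k\sum_{j\le k}t_j-r_kq_ku_{k-1}+r_k^2v_{k+1}\\ v_{k+1}+v_{k-1}+(1-r_kq_k)\left[q_{k+1}\sum_{j\le k}s_j-q_{k-1}\sum_{j\le k-1}s_j\right]-q_k\sum_{j\le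 k}t_j+q_k^2u_{k+1}-q_kr_kv_{k-1}\end{pmatrix}.$$ Finally $$\mathcal R=\begin{pmatrix}0&1\\-1&0\end{pmatrix}(\mathcal L_++\mathcal L_-)\begin{pmatrix}0&-1\\1&0\end{pmatrix},\qquad \mathcal K=\mathcal R\mathcal J.$$ *)

(* Defs.v *)
From Stdlib Require Import Reals ZArith Lra Lia.
From Coquelicot Require Import Coquelicot.
Open Scope C_scope.

(** * Doubly infinite sequences and sums *)

(** [w k] is the column vector at the site [k]: the pair (q_k, r_k) for a
    point of the phase space, (a_k, b_k) for a tangent vector. *)
Definition cseq : Type := Z -> C * C.

Definition CSeries (a : nat -> C) : C :=
  (Series (fun n => fst (a n)), Series (fun n => snd (a n))).

Definition sum_ge (k : Z) (f : Z -> C) : C :=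
  CSeries (fun n => f (k + Z.of_nat n)%Z).

Definition sum_le (k : Z) (f : Z -> C) : C :=
  CSeries (fun n => f (k - Z.of_nat n)%Z).

Definition sum_Z (f : Z -> C) : C := sum_ge 0%Z f + sum_le (-1)%Z f.

(** * Phase space *)

(** Rapid decay: faster than every power of [k].  Every sum below converges
    when the sequences involved decay rapidly. *)
Definition rapid (w : cseq) : Prop :=
  forall m : nat, exists M : R, forall k : Z,
    ((1 + IZR (Z.abs k)) ^ m * (Cmod (fst (w k)) + Cmod (snd (w k))) <= M)%R.

Definition phase_space (p : cseq) : Prop :=
  rapid p /\ forall k : Z, 1 - snd (p k) * fst (p k) <> 0.

(** The bilinear (not Hermitian) form on the tangent space at [p]. *)
Definition form (p w z : cseq) : C :=
  - sum_Z (fun k => (fst (w k) * snd (z k) + snd (w k) * fst (z k))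
                    / (1 - fst (p k) * snd (p k))).

(** * Functionals and their gradients *)

(** A functional is given by its values on the phase space; as the complex
    logarithm is many-valued there, values count only modulo [2 i PI].
    [branch F p] is the determination of [F] near [p]: [branch F p p'] is the number
    congruent to [F p'] modulo [2 i PI] whose imaginary part lies in
    [Im (F p) - PI, Im (F p) + PI[.  Near [p] it is equal to [F] when [F] is
    continuous at [p], so for such functionals the derivatives below are the
    ordinary ones. *)
Definition functional : Type := cseq -> C.

Definition branch (F : functional) (p p' : cseq) : C :=
  (fst (F p'),
   (snd (F p') - 2 * PI * IZR (Int_part ((snd (F p') - snd (F p)) / (2 * PI)
                                         + / 2)))%R).

Definition shift (p : cseq) (t : C) (v : cseq) : cseq :=
  fun k => (fst (p k) + t * fst (v k), snd (p k) + t * snd (v k)).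

Definition delta (k j : Z) : C := if Z.eq_dec j k then 1 else 0.
Definition unit_q (k : Z) : cseq := fun j => (delta k j, RtoC 0).
Definition unit_r (k : Z) : cseq := fun j => (RtoC 0, delta k j).

(** delta F / delta q_k and delta F / delta r_k at [p]. *)
Definition delta_q (F : functional) (p : cseq) (k : Z) : C :=
  C_derive (fun t => branch F p (shift p t (unit_q k))) 0.
Definition delta_r (F : functional) (p : cseq) (k : Z) : C :=
  C_derive (fun t => branch F p (shift p t (unit_r k))) 0.

Definition grad (F : functional) (p : cseq) : cseq :=
  fun k => (- (1 - fst (p k) * snd (p k)) * delta_r F p k,
            - (1 - fst (p k) * snd (p k)) * delta_q F p k).

(** [F] is holomorphic along every complex line in a tangent direction [v],
    with differential [form p (grad F p) v], that is, the sum over [k] of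
    (delta F / delta q_k) a_k + (delta F / delta r_k) b_k for [v] = (a, b). *)
Definition differentiable (F : functional) : Prop :=
  forall p : cseq, phase_space p ->
    rapid (grad F p) /\
    forall v : cseq, rapid v ->
      is_derive (fun t : C => branch F p (shift p t v)) (RtoC 0) (form p (grad F p) v).

(** * The functional H_0 *)

(** Principal argument, in ]-PI, PI], for nonzero [z] (half-angle formula). *)
Definition Carg (z : C) : R :=
  (if Req_dec_T (Cmod z + fst z) 0 then PI
   else 2 * atan (snd z / (Cmod z + fst z)))%R.

Definition Clog (z : C) : C := (ln (Cmod z), Carg z).

Lemma Clog_correct (z : C) : z <> 0 ->
  z = (exp (fst (Clog z)) * cos (snd (Clog z)),
       exp (fst (Clog z)) * sin (snd (Clog z)))%R
  /\ (- PI < snd (Clog z) <= PI)%R.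
Proof.
intros Hz; pose proof (proj1 (Cmod_gt_0 z) Hz) as Hc; simpl.
rewrite (exp_ln _ Hc).
destruct z as [x y]; unfold Carg; simpl fst in *; simpl snd in *.
assert (Hcc : (Cmod (x, y) * Cmod (x, y) = x * x + y * y)%R).
{ unfold Cmod; simpl fst; simpl snd; rewrite sqrt_sqrt; nra. }
set (c := Cmod (x, y)) in *; clearbody c.
pose proof PI_RGT_0 as HPI.
destruct (Req_dec_T (c + x) 0) as [H0|H0].
- rewrite cos_PI, sin_PI; split; [|lra].
  assert (y = 0)%R by nra; f_equal; nra.
- assert (Hs : (0 < c + x)%R) by nra.
  pose proof (atan_bound (y / (c + x))) as Hb.
  split; [|lra].
  rewrite cos_2a, sin_2a, cos_atan, sin_atan.
  set (t := (y / (c + x))%R).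
  assert (Ht : (0 < 1 + t²)%R) by (unfold Rsqr; nra).
  pose proof (sqrt_lt_R0 _ Ht) as Hr; pose proof (sqrt_sqrt _ (Rlt_le _ _ Ht)) as Hrr.
  set (d := sqrt (1 + t²)) in *; clearbody d.
  assert (Hd : ((1 + t²) * (c + x) = 2 * c)%R).
  { unfold t, Rsqr; field_simplify; [|lra].
    apply (Rmult_eq_reg_r (c + x)); [|lra]; field_simplify; [|lra]; nra. }
  assert (Hty : (t * (c + x) = y)%R) by (unfold t; field; lra).
  clearbody t; unfold Rsqr in *.
  assert (Hdd : (d * d * (c + x) = 2 * c)%R) by (rewrite Hrr; exact Hd).
  f_equal; apply (Rmult_eq_reg_r (d * d)); try nra.
  + transitivity (c * (1 - t * t))%R; [|field; lra].
    rewrite Hrr; nra.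
  + transitivity (2 * c * t)%R; [|field; lra].
    rewrite <- Hdd, <- Hty; ring_simplify; nra.
Qed.

Definition H0 : functional :=
  fun p => - sum_Z (fun k => Clog (1 - fst (p k) * snd (p k))).

(** * The operators *)

(** [p] = (q, r) is the base point and
    [w] = (u, v) the sequence acted upon. *)
Definition ssum (p w : cseq) (j : Z) : C :=
  (fst (p j) * fst (w j) - snd (p j) * snd (w j)) / (1 - snd (p j) * fst (p j)).

Definition opL (p w : cseq) : cseq := fun k =>
  let q j := fst (p j) in let r j := snd (p j) in
  let u j := fst (w j) in let v j := snd (w j) in
  let s := ssum p w in
  let c j := q j * u (j - 1)%Z - r j * v (j + 1)%Z in
  (u (k - 1)%Z - (1 - r k * q k) * r (k - 1)%Z * sum_ge k s
     - r k * sum_ge k c,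
   v (k + 1)%Z - (1 - r k * q k) * q (k + 1)%Z * sum_ge (k + 1) s
     - q k * sum_ge (k + 1) c).

Definition opLinv (p w : cseq) : cseq := fun k =>
  let q j := fst (p j) in let r j := snd (p j) in
  let u j := fst (w j) in let v j := snd (w j) in
  let s := ssum p w in
  let c j := q j * u (j + 1)%Z - r j * v (j - 1)%Z in
  (u (k + 1)%Z + (1 - r k * q k) * r (k + 1)%Z * sum_ge (k + 1) s
     + r k * sum_ge (k + 1) c,
   v (k - 1)%Z + (1 - r k * q k) * q (k - 1)%Z * sum_ge k s
     + q k * sum_ge k c).

Definition cadd (w z : cseq) : cseq :=
  fun k => (fst (w k) + fst (z k), snd (w k) + snd (z k)).

Definition opLplus (p w : cseq) : cseq := cadd (opL p w) (opLinv p w).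

(** Explicit form of [sigma_3 o opLplus^* o sigma_3^-1], where [^*] is the
    adjoint for [form p] and [sigma_3 = diag (1, -1)]. *)
Definition opLminus (p w : cseq) : cseq := fun k =>
  let q j := fst (p j) in let r j := snd (p j) in
  let u j := fst (w j) in let v j := snd (w j) in
  let s := ssum p w in
  let t j := q j * (u (j + 1)%Z - u (j - 1)%Z)
             + r j * (v (j + 1)%Z - v (j - 1)%Z) in
  (u (k + 1)%Z + u (k - 1)%Z
     - (1 - r k * q k) * (r (k + 1)%Z * sum_le k s
                          - r (k - 1)%Z * sum_le (k - 1) s)
     - r k * sum_le k t - r k * q k * u (k - 1)%Z + r k * r k * v (k + 1)%Z,
   v (k + 1)%Z + v (k - 1)%Z
     + (1 - r k * q k) * (q (k + 1)%Z * sum_le k s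
                          - q (k - 1)%Z * sum_le (k - 1) s)
     - q k * sum_le k t + q k * q k * u (k + 1)%Z - q k * r k * v (k - 1)%Z).

Definition opJ (w : cseq) : cseq :=
  fun k => (- Ci * fst (w k), Ci * snd (w k)).

Definition opR (p w : cseq) : cseq :=
  let w' : cseq := fun k => (- snd (w k), fst (w k)) in
  let z := cadd (opLplus p w') (opLminus p w') in
  fun k => (snd (z k), - fst (z k)).

Definition opK (p w : cseq) : cseq := opR p (opJ w).

Definition X (n : nat) (p : cseq) : cseq :=
  Nat.iter n (opR p) (opJ (grad H0 p)).

(* Main.v *)
Require Import Defs.
From Stdlib Require Import Reals ZArith Lra Lia FunctionalExtensionality.
From Coquelicot Require Import Coquelicot.
Import Defs.
Open Scope C_scope.

(** Why the theorem is true.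

    The hierarchy is that of the Ablowitz-Ladik lattice, whose linear problem
    is psi_{k+1} = U_k psi_k with U_k = [[X, q_k], [X r_k, 1]] and spectral
    parameter X.  As formal power series in X there is a unique rank-one
    projector P_k = [[X a_k, B_k], [X c_k, 1 - X a_k]] with
    P_{k+1} U_k = U_k P_k, without constant term in a, B, c as functions of
    (q, r).  Written in coordinates it solves the system [res_B_eq],
    [res_c_eq], [res_a_eq], which determines the coefficients of a, B, c one
    after the other as polynomials in finitely many neighbouring q_j, r_j;
    they therefore decay rapidly in k.  Two consequences linear
    in a, B, c, namely
    a_{k+1} - a_k = q_k c_{k+1} - r_k B_k ([res_diff]) and
    X (a_{k+1} - a_k) = q_k c_k - r_k B_{k+1} ([res_X_diff]), make every sum
    occurring in the operators telescope.

    Let Y_0 = (r, q), let Y_{m+1} be the coefficient of X^m in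
    (c_{k+1} - r_k a_{k+1}, B_k - q_k a_k), and let Y_{-m} be obtained from Y_m
    by exchanging q with r and the two components.  Once the sums have
    telescoped, the resolvent system gives
    (L_+ + L_-) Y_m = 2 (Y_{m+1} + Y_{m-1}) for every integer m
    ([hierarchy_field_step]).  Up to the sign and the order of components
    recorded in [gradient_of], Y_0 is the gradient of H_0, and it remains to
    see that every Y_m is a gradient: H_n is then the combination of the
    corresponding functionals with the coefficients of (2 (S + 1/S))^n, S being
    the shift of m ([chain]).

    For m >= 0 the functional with gradient Y_{m+1} is the sum over k of
    a_k^{(m)} / (m + 1) ([hamiltonian]).  Indeed X a_k is
    tr (P_k U_k^{-1} X dU_k/dX), so this is the closedness of the one-form
    delta -> sum_k tr (P_k U_k^{-1} delta U_k) in the two directions d/dt and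
    X d/dX.  Closedness holds because the failure at one site is the difference
    between the sites k + 1 and k of the curvature tr (P [d_t P, d_X P]) of the
    family of projectors ([curvature_transport]), which telescopes.  The
    division by m + 1 comes from X d/dX.

    The analytic part is first order expansions that are uniform in the site
    ([jet]), so that sums over the lattice may be differentiated term by term.
    H_0 needs in addition a continuous determination of the sum of logarithms
    near a given point ([has_lift]). *)

(** * Sums over the integers *)

(** Domination by the inverse square of 1 + |k|, which is enough for absolute
    convergence and gives it an explicit bound. *)

Definition decay2 (f : Z -> C) : Prop :=
  exists M : R, forall k, ((1 + IZR (Z.abs k)) ^ 2 * Cmod (f k) <= M)%R.

Lemma one_le_weight (k : Z) : (1 <= 1 + IZR (Z.abs k))%R.
Proof. pose proof (IZR_le 0 (Z.abs k) (Z.abs_nonneg k)); lra. Qed.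

Lemma weight_pow_pos (m : nat) (k : Z) : (0 < (1 + IZR (Z.abs k)) ^ m)%R.
Proof. apply pow_lt; pose proof (one_le_weight k); lra. Qed.

Lemma im_le_Cmod (z : C) : (Rabs (snd z) <= Cmod z)%R.
Proof. eapply Rle_trans; [apply Rmax_r | apply Rmax_Cmod]. Qed.

Lemma Cmod_le_re_im (z : C) : (Cmod z <= Rabs (fst z) + Rabs (snd z))%R.
Proof.
replace z with (RtoC (fst z) + Ci * RtoC (snd z)) at 1.
- eapply Rle_trans; [apply Cmod_triangle|].
  rewrite Cmod_mult, Cmod_Ci, !Cmod_R; lra.
- destruct z as [x y]; unfold Ci, RtoC, Cplus, Cmult; simpl; f_equal; ring.
Qed.

Lemma is_series_telescope (g : nat -> R) :
  is_lim_seq g 0 -> is_series (fun n => (g (S n) - g n)%R) (- g 0%nat)%R.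
Proof.
intros Hg.
change (is_lim_seq (sum_n (fun n => (g (S n) - g n)%R)) (- g 0%nat)%R).
apply (is_lim_seq_ext (fun n => (g (S n) - g 0%nat)%R)).
- intros n; induction n as [|n IH].
  + rewrite sum_O; reflexivity.
  + rewrite sum_Sn, <- IH; unfold plus; simpl; ring.
- replace (Finite (- g 0%nat)) with (Finite (0 - g 0%nat)) by (f_equal; ring).
  apply is_lim_seq_minus'; [|apply is_lim_seq_const].
  now apply is_lim_seq_incr_1 in Hg.
Qed.

Lemma ex_series_inv_square : ex_series (fun n => (/ (1 + INR n) ^ 2)%R).
Proof.
assert (Hpos : forall n, (0 < 1 + INR n)%R) by (intros n; pose proof (pos_INR n); lra).
apply (@ex_series_le R_AbsRing R_CompleteNormedModule _
  (fun n => (-2 * (/ (1 + INR (S n)) - / (1 + INR n)))%R)).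
- intros n; change (norm (/ (1 + INR n) ^ 2)%R) with (Rabs (/ (1 + INR n) ^ 2)).
  pose proof (Hpos n) as Hn; rewrite S_INR; set (x := (1 + INR n)%R) in *.
  replace (1 + (INR n + 1))%R with (x + 1)%R by (unfold x; ring).
  assert (1 <= x)%R by (unfold x; pose proof (pos_INR n); lra).
  rewrite Rabs_pos_eq by (left; apply Rinv_0_lt_compat, pow_lt; lra).
  replace (-2 * (/ (x + 1) - / x))%R with (2 / (x * (x + 1)))%R by (field; lra).
  apply (Rmult_le_reg_r (x ^ 2 * (x + 1))); [nra|].
  replace (/ x ^ 2 * (x ^ 2 * (x + 1)))%R with (x + 1)%R by (field; lra).
  replace (2 / (x * (x + 1)) * (x ^ 2 * (x + 1)))%R with (2 * x)%R by (field; lra).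
  lra.
- refine (@ex_series_scal R_AbsRing R_NormedModule (-2)%R (fun n => (/ (1 + INR (S n)) - / (1 + INR n))%R) _).
  exists (- / (1 + INR 0))%R; apply (is_series_telescope (fun n => (/ (1 + INR n))%R)).
  apply (is_lim_seq_inv _ p_infty); [|discriminate].
  apply (is_lim_seq_plus _ _ 1 p_infty); [apply is_lim_seq_const|apply is_lim_seq_INR|reflexivity].
Qed.

Definition inv_square_sum : R := Series (fun n => (/ (1 + INR n) ^ 2)%R).

Definition is_csum (a : nat -> C) (l : C) : Prop :=
  is_series (fun n => fst (a n)) (fst l) /\ is_series (fun n => snd (a n)) (snd l).

Lemma is_csum_unique a l : is_csum a l -> CSeries a = l.
Proof.
intros [H1 H2]; unfold CSeries; rewrite (is_series_unique _ _ H1), (is_series_unique _ _ H2).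
now destruct l.
Qed.

Lemma is_csum_lin a b la lb (x y : C) :
  is_csum a la -> is_csum b lb ->
  is_csum (fun n => x * a n + y * b n) (x * la + y * lb).
Proof.
intros [A1 A2] [B1 B2].
split.
- evar (l : R); replace (fst (x * la + y * lb)) with l; subst l.
  + eapply is_series_ext; [|apply (is_series_plus _ _ _ _
      (is_series_minus _ _ _ _ (is_series_scal (fst x) _ _ A1) (is_series_scal (snd x) _ _ A2))
      (is_series_minus _ _ _ _ (is_series_scal (fst y) _ _ B1) (is_series_scal (snd y) _ _ B2)))].
    intros n; simpl; unfold plus, opp, scal; simpl; unfold mult; simpl; ring.
  + simpl; unfold plus, opp, scal; simpl; unfold mult; simpl; ring.
- evar (l : R); replace (snd (x * la + y * lb)) with l; subst l.
  + eapply is_series_ext; [|apply (is_series_plus _ _ _ _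
      (is_series_plus _ _ _ _ (is_series_scal (fst x) _ _ A2) (is_series_scal (snd x) _ _ A1))
      (is_series_plus _ _ _ _ (is_series_scal (fst y) _ _ B2) (is_series_scal (snd y) _ _ B1)))].
    intros n; simpl; unfold plus, opp, scal; simpl; unfold mult; simpl; ring.
  + simpl; unfold plus, opp, scal; simpl; unfold mult; simpl; ring.
Qed.

Lemma csum_bound (a : nat -> C) (M : R) :
  (forall n, (1 + INR n) ^ 2 * Cmod (a n) <= M)%R ->
  is_csum a (CSeries a) /\ (Cmod (CSeries a) <= 2 * (M * inv_square_sum))%R.
Proof.
intros Ha.
assert (Hb : forall n, (Cmod (a n) <= M * / (1 + INR n) ^ 2)%R).
{ intros n; assert (0 < (1 + INR n) ^ 2)%R by (apply pow_lt; pose proof (pos_INR n); lra).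
  apply (Rmult_le_reg_l ((1 + INR n) ^ 2)); [easy|].
  replace ((1 + INR n) ^ 2 * (M * / (1 + INR n) ^ 2))%R with M by (field; pose proof (pos_INR n); lra).
  apply Ha. }
assert (Hs : ex_series (fun n => (M * / (1 + INR n) ^ 2)%R)).
{ refine (@ex_series_scal R_AbsRing R_NormedModule M (fun n => (/ (1 + INR n) ^ 2)%R) _).
  apply ex_series_inv_square. }
assert (Hcomp : forall x : nat -> R, (forall n, Rabs (x n) <= Cmod (a n))%R ->
  is_series x (Series x) /\ (Rabs (Series x) <= M * inv_square_sum)%R).
{ intros x Hx.
  assert (Hx' : forall n, (Rabs (x n) <= M * / (1 + INR n) ^ 2)%R)
    by (intros n; eapply Rle_trans; [apply Hx|apply Hb]).
  split.
  - apply Series_correct.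
    now apply (@ex_series_le R_AbsRing R_CompleteNormedModule x (fun n => (M * / (1 + INR n) ^ 2)%R)).
  - eapply Rle_trans; [apply Series_Rabs|].
    + apply (@ex_series_le R_AbsRing R_CompleteNormedModule _ (fun n => (M * / (1 + INR n) ^ 2)%R)); [|easy].
      intros n; change (norm (Rabs (x n))) with (Rabs (Rabs (x n))); now rewrite Rabs_Rabsolu.
    + unfold inv_square_sum; rewrite <- Series_scal_l.
      apply Series_le; [|easy]; intros n; split; [apply Rabs_pos|apply Hx']. }
destruct (Hcomp (fun n => fst (a n))) as [A1 A2]; [intros n; apply re_le_Cmod|].
destruct (Hcomp (fun n => snd (a n))) as [B1 B2]; [intros n; apply im_le_Cmod|].
split; [now split|].
eapply Rle_trans; [apply Cmod_le_re_im|]; unfold CSeries; simpl; lra.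
Qed.

(** [sum_Z] is total, so linearity has to be proved for this relation, which
    asserts convergence as well. *)
Definition is_sum_Z (f : Z -> C) (l : C) : Prop :=
  exists l1 l2, is_csum (fun n => f (0 + Z.of_nat n)%Z) l1 /\
    is_csum (fun n => f (-1 - Z.of_nat n)%Z) l2 /\ l = l1 + l2.

Lemma is_sum_Z_unique f l : is_sum_Z f l -> sum_Z f = l.
Proof.
intros (l1 & l2 & H1 & H2 & ->); unfold sum_Z, sum_ge, sum_le.
now rewrite (is_csum_unique _ _ H1), (is_csum_unique _ _ H2).
Qed.

Lemma is_sum_Z_lin f g lf lg (x y : C) :
  is_sum_Z f lf -> is_sum_Z g lg ->
  is_sum_Z (fun k => x * f k + y * g k) (x * lf + y * lg).
Proof.
intros (l1 & l2 & H1 & H2 & ->) (m1 & m2 & K1 & K2 & ->).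
exists (x * l1 + y * m1), (x * l2 + y * m2); repeat split;
  try (apply (is_csum_lin _ _ _ _ x y H1 K1)); try (apply (is_csum_lin _ _ _ _ x y H2 K2)).
ring.
Qed.

(** Besides convergence, this gives a bound proportional to the constant [M];
    it is what makes remainders of order t^2 remain so after summation. *)
Lemma sum_Z_bound (f : Z -> C) (M : R) :
  (forall k, (1 + IZR (Z.abs k)) ^ 2 * Cmod (f k) <= M)%R ->
  is_sum_Z f (sum_Z f) /\ (Cmod (sum_Z f) <= 4 * (M * inv_square_sum))%R.
Proof.
intros Hf.
destruct (csum_bound (fun n => f (0 + Z.of_nat n)%Z) M) as [A1 A2].
{ intros n; rewrite INR_IZR_INZ; specialize (Hf (0 + Z.of_nat n)%Z).
  now replace (Z.abs (0 + Z.of_nat n)) with (Z.of_nat n) in Hf by lia. }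
destruct (csum_bound (fun n => f (-1 - Z.of_nat n)%Z) M) as [B1 B2].
{ intros n; rewrite INR_IZR_INZ; specialize (Hf (-1 - Z.of_nat n)%Z).
  eapply Rle_trans; [|apply Hf]; apply Rmult_le_compat_r; [apply Cmod_ge_0|].
  apply pow_incr; pose proof (IZR_le _ _ (Nat2Z.is_nonneg n)); split; [lra|].
  apply Rplus_le_compat_l, IZR_le; lia. }
split; [now exists (sum_ge 0 f), (sum_le (-1) f)|].
unfold sum_Z, sum_ge, sum_le; eapply Rle_trans; [apply Cmod_triangle|]; lra.
Qed.

Lemma sum_Z_correct (f : Z -> C) : decay2 f -> is_sum_Z f (sum_Z f).
Proof. intros [M HM]; now apply (sum_Z_bound f M). Qed.

Lemma decay2_lin (f g : Z -> C) (x y : C) :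
  decay2 f -> decay2 g -> decay2 (fun k => x * f k + y * g k).
Proof.
intros [M HM] [N HN]; exists (Cmod x * M + Cmod y * N)%R; intros k.
pose proof (weight_pow_pos 2 k); set (w := ((1 + IZR (Z.abs k)) ^ 2)%R) in *.
specialize (HM k); specialize (HN k); fold w in HM, HN.
pose proof (Cmod_triangle (x * f k) (y * g k)) as Ht; rewrite !Cmod_mult in Ht.
pose proof (Cmod_ge_0 x); pose proof (Cmod_ge_0 y).
pose proof (Rmult_le_compat_l _ _ _ H0 HM); pose proof (Rmult_le_compat_l _ _ _ H1 HN).
nra.
Qed.

Lemma sum_Z_lin (f g : Z -> C) (x y : C) :
  decay2 f -> decay2 g ->
  sum_Z (fun k => x * f k + y * g k) = x * sum_Z f + y * sum_Z g.
Proof.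
intros Hf Hg; apply is_sum_Z_unique, is_sum_Z_lin; now apply sum_Z_correct.
Qed.

Lemma sum_Z_opp (f : Z -> C) : sum_Z (fun k => - f k) = - sum_Z f.
Proof.
unfold sum_Z, sum_ge, sum_le, CSeries; simpl; rewrite !Series_opp.
unfold Cplus, Copp; simpl; f_equal; ring.
Qed.

Lemma sum_Z_ext (f g : Z -> C) : (forall k, f k = g k) -> sum_Z f = sum_Z g.
Proof. intros H; f_equal; now apply functional_extensionality. Qed.

(** * Rapidly decreasing sequences *)

(** The parameter [t] is the one of a line through the phase space; only small
    values of it matter. *)
Definition uniformly_rapid (e : C -> Z -> C) : Prop :=
  forall m : nat, exists M : R, forall (k : Z) (t : C), (Cmod t <= 1)%R ->
    ((1 + IZR (Z.abs k)) ^ m * Cmod (e t k) <= M)%R.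

Definition rapidC (f : Z -> C) : Prop := uniformly_rapid (fun _ => f).

Lemma rapidC_spec f : rapidC f ->
  forall m, exists M, forall k, ((1 + IZR (Z.abs k)) ^ m * Cmod (f k) <= M)%R.
Proof.
intros H m; destruct (H m) as [M HM]; exists M; intros k.
apply (HM k 0); rewrite Cmod_0; lra.
Qed.

Lemma rapidC_decay2 f : rapidC f -> decay2 f.
Proof. intros H; exact (rapidC_spec f H 2%nat). Qed.

Lemma uniformly_rapid_ext e e' :
  (forall t k, e t k = e' t k) -> uniformly_rapid e -> uniformly_rapid e'.
Proof.
intros H He m; destruct (He m) as [M HM]; exists M; intros k t Ht.
rewrite <- H; now apply HM.
Qed.

Lemma uniformly_rapid_plus e e' : uniformly_rapid e -> uniformly_rapid e' ->
  uniformly_rapid (fun t k => e t k + e' t k).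
Proof.
intros H H' m; destruct (H m) as [M HM], (H' m) as [M' HM']; exists (M + M')%R.
intros k t Ht; specialize (HM k t Ht); specialize (HM' k t Ht).
pose proof (Cmod_triangle (e t k) (e' t k)).
pose proof (Rmult_le_compat_l _ _ _ (Rlt_le _ _ (weight_pow_pos m k)) H0); lra.
Qed.

Lemma uniformly_rapid_bmul b e (K : R) :
  (forall t k, (Cmod t <= 1)%R -> (Cmod (b t k) <= K)%R) -> uniformly_rapid e ->
  uniformly_rapid (fun t k => b t k * e t k).
Proof.
intros Hb H m; destruct (H m) as [M HM]; exists (K * M)%R; intros k t Ht.
specialize (HM k t Ht); specialize (Hb t k Ht); rewrite Cmod_mult.
pose proof (weight_pow_pos m k); pose proof (Cmod_ge_0 (b t k)); pose proof (Cmod_ge_0 (e t k)).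
replace ((1 + IZR (Z.abs k)) ^ m * (Cmod (b t k) * Cmod (e t k)))%R
  with (Cmod (b t k) * ((1 + IZR (Z.abs k)) ^ m * Cmod (e t k)))%R by ring.
apply Rmult_le_compat; try easy.
apply Rmult_le_pos; lra.
Qed.

Lemma uniformly_rapid_bounded e : uniformly_rapid e ->
  exists K, forall t k, (Cmod t <= 1)%R -> (Cmod (e t k) <= K)%R.
Proof.
intros H; destruct (H 0%nat) as [M HM]; exists M; intros t k Ht.
specialize (HM k t Ht); simpl in HM; lra.
Qed.

Lemma uniformly_rapid_mult e e' : uniformly_rapid e -> uniformly_rapid e' ->
  uniformly_rapid (fun t k => e t k * e' t k).
Proof.
intros H H'; destruct (uniformly_rapid_bounded e H) as [K HK].
now apply (uniformly_rapid_bmul e e' K).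
Qed.

Lemma uniformly_rapid_param e : uniformly_rapid e -> uniformly_rapid (fun t k => t * e t k).
Proof. now apply (uniformly_rapid_bmul (fun t _ => t) e 1). Qed.

Lemma uniformly_rapid_scal (x : C) e : uniformly_rapid e -> uniformly_rapid (fun t k => x * e t k).
Proof. apply (uniformly_rapid_bmul (fun _ _ => x) e (Cmod x)); intros; lra. Qed.

(** Translation costs a power of 1 + |j|, by
    1 + |k| <= (1 + |j|) (1 + |k + j|). *)
Lemma uniformly_rapid_translate (j : Z) e : uniformly_rapid e ->
  uniformly_rapid (fun t k => e t (k + j)%Z).
Proof.
intros H m; destruct (H m) as [M HM]; exists ((1 + IZR (Z.abs j)) ^ m * M)%R; intros k t Ht.
specialize (HM (k + j)%Z t Ht).
eapply Rle_trans; [|apply Rmult_le_compat_l; [left; apply weight_pow_pos|exact HM]].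
rewrite <- Rmult_assoc; apply Rmult_le_compat_r; [apply Cmod_ge_0|].
rewrite <- Rpow_mult_distr; apply pow_incr; pose proof (one_le_weight k); split; [lra|].
assert (Z.abs k <= Z.abs j + Z.abs (k + j))%Z as Hk by lia.
apply IZR_le in Hk; rewrite plus_IZR in Hk.
pose proof (one_le_weight j); pose proof (one_le_weight (k + j)); nra.
Qed.

Lemma rapidC_ext f g : (forall k, f k = g k) -> rapidC f -> rapidC g.
Proof. intros H; apply uniformly_rapid_ext; intros _; apply H. Qed.

Lemma rapidC_plus f g : rapidC f -> rapidC g -> rapidC (fun k => f k + g k).
Proof. apply uniformly_rapid_plus. Qed.

Lemma rapidC_mult f g : rapidC f -> rapidC g -> rapidC (fun k => f k * g k).
Proof. apply uniformly_rapid_mult. Qed.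

Lemma rapidC_scal x f : rapidC f -> rapidC (fun k => x * f k).
Proof. apply uniformly_rapid_scal. Qed.

Lemma rapidC_bmul b f (K : R) :
  (forall k, (Cmod (b k) <= K)%R) -> rapidC f -> rapidC (fun k => b k * f k).
Proof. intros H; apply (uniformly_rapid_bmul (fun _ => b) _ K); intros t k _; apply H. Qed.

Lemma rapidC_opp f : rapidC f -> rapidC (fun k => - f k).
Proof. intros H; apply (rapidC_ext (fun k => (-1) * f k) (fun k => - f k)); [intros k; ring|now apply rapidC_scal]. Qed.

Lemma rapidC_minus f g : rapidC f -> rapidC g -> rapidC (fun k => f k - g k).
Proof. intros Hf Hg; apply rapidC_plus; [easy|now apply rapidC_opp]. Qed.

Lemma rapidC_translate (j : Z) f : rapidC f -> rapidC (fun k => f (k + j)%Z).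
Proof. apply (uniformly_rapid_translate j (fun _ => f)). Qed.

Lemma rapidC_0 : rapidC (fun _ => 0).
Proof. intros m; exists 0%R; intros k t _; rewrite Cmod_0; lra. Qed.

Lemma rapid_iff (w : cseq) :
  rapid w <-> rapidC (fun k => fst (w k)) /\ rapidC (fun k => snd (w k)).
Proof.
split.
- intros H; split; intros m; destruct (H m) as [M HM]; exists M; intros k t _;
    specialize (HM k); pose proof (weight_pow_pos m k);
    pose proof (Cmod_ge_0 (fst (w k))); pose proof (Cmod_ge_0 (snd (w k)));
    eapply Rle_trans; try exact HM; apply Rmult_le_compat_l; lra.
- intros [H1 H2] m.
  destruct (rapidC_spec _ H1 m) as [M HM], (rapidC_spec _ H2 m) as [N HN].
  exists (M + N)%R; intros k; specialize (HM k); specialize (HN k); simpl in *; lra.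
Qed.

(** * Telescoping sums *)

(** The two half lines on which sums are taken are the two choices of [h], and
    the real and imaginary parts the two choices of [x]. *)
Lemma rapidC_lim (g : Z -> C) (h : nat -> Z) :
  rapidC g -> (forall n, (Z.of_nat n <= Z.abs (h n) + Z.abs (h 0%nat))%Z) ->
  forall x : C -> R, (forall z, (Rabs (x z) <= Cmod z)%R) ->
  is_lim_seq (fun n => x (g (h n))) 0.
Proof.
intros Hg Hh x Hx; destruct (rapidC_spec g Hg 1%nat) as [M HM].
apply is_lim_seq_abs_0.
set (c := (1 + IZR (Z.abs (h 0%nat)))%R).
assert (Hc : (1 <= c)%R) by apply one_le_weight.
assert (HM0 : (0 <= M)%R).
{ eapply Rle_trans; [|apply (HM 0%Z)]; apply Rmult_le_pos; [|apply Cmod_ge_0].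
  left; apply weight_pow_pos. }
apply (is_lim_seq_le_le (fun _ => 0%R) _ (fun n => (c * M * / (1 + INR n))%R)).
- intros n; split; [apply Rabs_pos|].
  eapply Rle_trans; [apply Hx|].
  specialize (HM (h n)); specialize (Hh n); rewrite pow_1 in HM.
  apply IZR_le in Hh; rewrite plus_IZR, <- INR_IZR_INZ in Hh.
  pose proof (pos_INR n).
  apply (Rmult_le_reg_r (1 + INR n)); [lra|].
  replace (c * M * / (1 + INR n) * (1 + INR n))%R with (c * M)%R by (field; lra).
  apply Rle_trans with (Cmod (g (h n)) * (c * (1 + IZR (Z.abs (h n)))))%R.
  + apply Rmult_le_compat_l; [apply Cmod_ge_0|].
    pose proof (one_le_weight (h n)); unfold c in *; nra.
  + replace (Cmod (g (h n)) * (c * (1 + IZR (Z.abs (h n)))))%R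
      with (c * ((1 + IZR (Z.abs (h n))) * Cmod (g (h n))))%R by ring.
    apply Rmult_le_compat_l; lra.
- apply is_lim_seq_const.
- replace (Finite 0) with (Rbar_mult (c * M)%R 0) by (simpl; f_equal; ring).
  apply is_lim_seq_scal_l, (is_lim_seq_inv _ p_infty); [|discriminate].
  apply (is_lim_seq_plus _ _ 1 p_infty); [apply is_lim_seq_const|apply is_lim_seq_INR|reflexivity].
Qed.

(** [is_series] hides the type of the summands behind a structure projection,
   which [ring] does not see through. *)
Ltac real_ring := match goal with |- ?a = ?b => change (@eq R a b) end; ring.

Lemma is_csum_ge_telescope (g : Z -> C) (k : Z) : rapidC g ->
  is_csum (fun n => g (k + Z.of_nat n + 1)%Z - g (k + Z.of_nat n)%Z) (- g k).
Proof.
intros Hg.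
assert (Hh : forall n : nat, (Z.of_nat n <= Z.abs (k + Z.of_nat n) + Z.abs (k + Z.of_nat 0))%Z)
  by (intros; lia).
assert (E : forall n, (k + Z.of_nat n + 1)%Z = (k + Z.of_nat (S n))%Z) by (intros; lia).
assert (E0 : (k + Z.of_nat 0)%Z = k) by lia.
split; simpl.
- pose proof (is_series_telescope _ (rapidC_lim g (fun n => (k + Z.of_nat n)%Z) Hg Hh _ re_le_Cmod)) as H.
  unfold Re in H; cbv beta in H; rewrite E0 in H; revert H; apply is_series_ext; intros n; rewrite E; real_ring.
- pose proof (is_series_telescope _ (rapidC_lim g (fun n => (k + Z.of_nat n)%Z) Hg Hh _ im_le_Cmod)) as H.
  cbv beta in H; rewrite E0 in H; revert H; apply is_series_ext; intros n; rewrite E; real_ring.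
Qed.

Lemma is_csum_le_telescope (g : Z -> C) (k : Z) : rapidC g ->
  is_csum (fun n => g (k - Z.of_nat n + 1)%Z - g (k - Z.of_nat n)%Z) (g (k + 1)%Z).
Proof.
intros Hg.
assert (Hh : forall n : nat, (Z.of_nat n <= Z.abs (k + 1 - Z.of_nat n) + Z.abs (k + 1 - Z.of_nat 0))%Z)
  by (intros; lia).
assert (E : forall n, (k - Z.of_nat n)%Z = (k + 1 - Z.of_nat (S n))%Z) by (intros; lia).
assert (E1 : forall n, (k + 1 - Z.of_nat (S n) + 1)%Z = (k + 1 - Z.of_nat n)%Z) by (intros; lia).
assert (E0 : (k + 1 - Z.of_nat 0)%Z = (k + 1)%Z) by lia.
split; simpl.
- pose proof (is_series_opp _ _ (is_series_telescope _ (rapidC_lim g (fun n => (k + 1 - Z.of_nat n)%Z) Hg Hh _ re_le_Cmod))) as H.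
  unfold Re in H; cbv beta in H; rewrite E0 in H.
  replace (fst (g (k + 1)%Z)) with (opp (- fst (g (k + 1)%Z)))%R by (unfold opp; simpl; ring).
  revert H; apply is_series_ext; intros n; rewrite E, E1; unfold opp; simpl; real_ring.
- pose proof (is_series_opp _ _ (is_series_telescope _ (rapidC_lim g (fun n => (k + 1 - Z.of_nat n)%Z) Hg Hh _ im_le_Cmod))) as H.
  cbv beta in H; rewrite E0 in H.
  replace (snd (g (k + 1)%Z)) with (opp (- snd (g (k + 1)%Z)))%R by (unfold opp; simpl; ring).
  revert H; apply is_series_ext; intros n; rewrite E, E1; unfold opp; simpl; real_ring.
Qed.

Lemma sum_ge_telescope (f g : Z -> C) (k : Z) :
  rapidC g -> (forall j, f j = g (j + 1)%Z - g j) -> sum_ge k f = - g k.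
Proof.
intros Hg Hf; unfold sum_ge; apply is_csum_unique.
pose proof (is_csum_ge_telescope g k Hg) as H.
replace (fun n => f (k + Z.of_nat n)%Z)
  with (fun n => g (k + Z.of_nat n + 1)%Z - g (k + Z.of_nat n)%Z); [easy|].
apply functional_extensionality; intros n; now rewrite Hf.
Qed.

Lemma sum_le_telescope (f g : Z -> C) (k : Z) :
  rapidC g -> (forall j, f j = g (j + 1)%Z - g j) -> sum_le k f = g (k + 1)%Z.
Proof.
intros Hg Hf; unfold sum_le; apply is_csum_unique.
pose proof (is_csum_le_telescope g k Hg) as H.
replace (fun n => f (k - Z.of_nat n)%Z)
  with (fun n => g (k - Z.of_nat n + 1)%Z - g (k - Z.of_nat n)%Z); [easy|].
apply functional_extensionality; intros n; now rewrite Hf.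
Qed.

Lemma sum_Z_telescope (f g : Z -> C) :
  rapidC g -> (forall j, f j = g (j + 1)%Z - g j) -> sum_Z f = 0.
Proof.
intros Hg Hf; unfold sum_Z.
rewrite (sum_ge_telescope f g 0 Hg Hf), (sum_le_telescope f g (-1) Hg Hf).
simpl (-1 + 1)%Z; ring.
Qed.

(** * Formal power series *)

Definition fps : Type := nat -> C.

Declare Scope fps_scope.
Delimit Scope fps_scope with S.
Bind Scope fps_scope with fps.

Definition fps_const (x : C) : fps := fun n => match n with O => x | S _ => 0 end.
Definition fps_X : fps := fun n => match n with 1%nat => 1 | _ => 0 end.
Definition fps_add (f g : fps) : fps := fun n => f n + g n.
Definition fps_opp (f : fps) : fps := fun n => - f n.
Definition fps_sub (f g : fps) : fps := fun n => f n - g n.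
Definition fps_tail (f : fps) : fps := fun n => f (S n).

(** The Cauchy product, by recursion on the index through
    f g = f_0 g + X (tail f) g.  This form reduces the ring laws to inductions
    without any manipulation of finite sums. *)
Fixpoint fps_mul_coef (f g : fps) (n : nat) : C :=
  match n with
  | O => f O * g O
  | S m => f O * g (S m) + fps_mul_coef (fps_tail f) g m
  end.
Definition fps_mul (f g : fps) : fps := fps_mul_coef f g.

Notation "f + g" := (fps_add f g) : fps_scope.
Notation "f - g" := (fps_sub f g) : fps_scope.
Notation "f * g" := (fps_mul f g) : fps_scope.
Notation "- f" := (fps_opp f) : fps_scope.
Notation "0" := (fps_const 0) : fps_scope.
Notation "1" := (fps_const 1) : fps_scope.

Lemma fps_mul_S f g n : (f * g)%S (S n) = f O * g (S n) + (fps_tail f * g)%S n.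
Proof. reflexivity. Qed.

Lemma fps_mul_S' n : forall f g, (f * g)%S (S n) = f (S n) * g O + (f * fps_tail g)%S n.
Proof.
induction n as [|n IH]; intros f g; rewrite fps_mul_S.
- unfold fps_mul; simpl; unfold fps_tail; ring.
- rewrite IH, fps_mul_S; unfold fps_tail; ring.
Qed.

Lemma fps_mulC f g : (f * g)%S = (g * f)%S.
Proof.
apply functional_extensionality; intros n; revert f g; induction n as [|n IH]; intros f g.
- unfold fps_mul; simpl; ring.
- rewrite fps_mul_S, fps_mul_S', IH; ring.
Qed.

Lemma fps_mulDl f g h : ((f + g) * h)%S = (f * h + g * h)%S.
Proof.
apply functional_extensionality; intros n; revert f g; induction n as [|n IH]; intros f g.
- unfold fps_mul, fps_add; simpl; ring.
- unfold fps_add at 2; rewrite !fps_mul_S.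
  change (fps_tail (f + g)%S) with (fps_tail f + fps_tail g)%S; rewrite IH.
  unfold fps_add; ring.
Qed.

Lemma fps_scal_mul x f g n :
  (fps_mul (fun i => x * f i) g) n = x * (f * g)%S n.
Proof.
revert f; induction n as [|n IH]; intros f.
- unfold fps_mul; simpl; ring.
- rewrite !fps_mul_S.
  change (fps_tail (fun i => x * f i)) with (fun i => x * fps_tail f i); rewrite IH; ring.
Qed.

Lemma fps_mulA f g h : (f * (g * h))%S = ((f * g) * h)%S.
Proof.
apply functional_extensionality; intros n; revert f g h; induction n as [|n IH]; intros f g h.
- unfold fps_mul; simpl; ring.
- rewrite !(fps_mul_S f), (fps_mul_S g), IH, (fps_mul_S (f * g)%S).
  replace (fps_tail (f * g)%S) with (fps_add (fun i => f O * fps_tail g i) (fps_tail f * g)%S)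
    by reflexivity.
  rewrite fps_mulDl; unfold fps_add; rewrite fps_scal_mul.
  change ((f * g)%S 0%nat) with (f O * g O); ring.
Qed.

Lemma fps_const_mul x f n : (fps_const x * f)%S n = x * f n.
Proof.
assert (Z : forall (f : fps) n, (fps_mul (fun _ => 0) f) n = 0).
{ clear; intros f n; induction n as [|n IH].
  - unfold fps_mul; simpl; ring.
  - rewrite fps_mul_S; change (fps_tail (fun _ => 0)) with ((fun _ => 0) : fps); rewrite IH; ring. }
destruct n as [|n]; [reflexivity|].
rewrite fps_mul_S; change (fps_tail (fps_const x)) with ((fun _ => 0) : fps).
rewrite Z; simpl; ring.
Qed.

Lemma fps_X_mul_O f : (fps_X * f)%S O = 0.
Proof. unfold fps_mul; simpl; ring. Qed.

Lemma fps_X_mul_S f n : (fps_X * f)%S (S n) = f n.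
Proof.
rewrite fps_mul_S; change (fps_tail fps_X) with (fun n => match n with O => RtoC 1 | S _ => 0 end).
change (fun n => match n with O => RtoC 1 | S _ => RtoC 0 end) with (fps_const 1).
rewrite fps_const_mul; simpl; ring.
Qed.

Lemma fps_ring_theory : ring_theory 0%S 1%S fps_add fps_mul fps_sub fps_opp (@eq fps).
Proof.
constructor; intros; try apply fps_mulC; try apply fps_mulA; try apply fps_mulDl;
  apply functional_extensionality; intros n; try rewrite fps_const_mul;
  unfold fps_add, fps_opp, fps_sub; destruct n; simpl; ring.
Qed.

Add Ring fps_ring : fps_ring_theory.

(** A series with nonzero constant term may be cancelled: the lowest nonzero
    coefficient of [g] would survive in the product. *)
Lemma fps_regular (f g : fps) : f O <> 0 -> (f * g = 0)%S -> g = 0%S.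
Proof.
intros Hf H.
assert (Z : forall n (g : fps), (forall i, (i <= n)%nat -> g i = 0) -> forall h, (h * g)%S n = 0).
{ clear; intros n g; induction n as [|n IH]; intros Hg h.
  - unfold fps_mul; simpl; rewrite (Hg O) by lia; ring.
  - rewrite fps_mul_S, (Hg (S n)), IH by (intros; auto; apply Hg; lia); ring. }
assert (Hg : forall n i, (i <= n)%nat -> g i = 0).
{ induction n as [|n IH]; intros i Hi.
  - assert (i = O) as -> by lia.
    assert (Hn : (f * g)%S O = 0) by (now rewrite H).
    change (f O * g O = 0) in Hn.
    replace (g O) with (/ f O * (f O * g O)) by (now field); rewrite Hn; ring.
  - destruct (Nat.eq_dec i (S n)) as [->|]; [|apply IH; lia].
    assert (Hn : (f * g)%S (S n) = 0) by (now rewrite H).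
    rewrite fps_mul_S, (Z n g IH) in Hn.
    replace (g (S n)) with (/ f O * (f O * g (S n) + 0)) by (now field); rewrite Hn; ring. }
apply functional_extensionality; intros n; rewrite (Hg n n) by lia; now destruct n.
Qed.

(** The derivation [X d/dX]. *)
Definition fps_euler (f : fps) : fps := fun n => RtoC (INR n) * f n.

Lemma fps_euler_add f g : fps_euler (f + g)%S = (fps_euler f + fps_euler g)%S.
Proof. apply functional_extensionality; intros n; unfold fps_euler, fps_add; ring. Qed.

Lemma fps_euler_sub f g : fps_euler (f - g)%S = (fps_euler f - fps_euler g)%S.
Proof. apply functional_extensionality; intros n; unfold fps_euler, fps_sub; ring. Qed.

Lemma fps_euler_const x : fps_euler (fps_const x) = 0%S.
Proof. apply functional_extensionality; intros [|n]; unfold fps_euler; simpl fps_const; [simpl|]; ring. Qed.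

Lemma fps_euler_X : fps_euler fps_X = fps_X.
Proof. apply functional_extensionality; intros [|[|n]]; unfold fps_euler, fps_X; simpl INR; ring. Qed.

Lemma fps_euler_mul f g : fps_euler (f * g)%S = (fps_euler f * g + f * fps_euler g)%S.
Proof.
apply functional_extensionality; intros n; revert f; induction n as [|n IH]; intros f.
- unfold fps_euler, fps_add, fps_mul; simpl; ring.
- unfold fps_euler at 1, fps_add at 1; rewrite !fps_mul_S.
  replace (fps_tail (fps_euler f)) with (fps_euler (fps_tail f) + fps_tail f)%S.
  + rewrite fps_mulDl; specialize (IH (fps_tail f)); unfold fps_add in *.
    set (A := (fps_euler (fps_tail f) * g)%S n) in *.
    set (B := (fps_tail f * fps_euler g)%S n) in *.
    unfold fps_euler at 1 in IH; unfold fps_euler.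
    replace A with (RtoC (INR n) * (fps_tail f * g)%S n - B) by (rewrite IH; ring).
    rewrite S_INR, RtoC_plus; simpl; ring.
  + apply functional_extensionality; intros m; unfold fps_euler, fps_add, fps_tail.
    rewrite S_INR, RtoC_plus; ring.
Qed.

(** * The resolvent of the linear problem *)

(** The entries of the projector [[X a, B], [X c, 1 - X a]] at each site. *)
Record resolvent := Resolvent { res_a : Z -> fps; res_B : Z -> fps; res_c : Z -> fps }.

(** The equation P_{k+1} U_k = U_k P_k determines B by its left neighbour and c
   by its right neighbour; this is the direction in which the factor X appears,
   so that the coefficients can be computed successively. *)
Definition res_step_B (q : Z -> C) (s : resolvent) (k : Z) : fps :=
  (fps_const (q (k - 1)%Z) - fps_X * (fps_const (q (k - 1)%Z) * (res_a s (k - 1) + res_a s k))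
   + fps_X * res_B s (k - 1))%S.

Definition res_step_c (r : Z -> C) (s : resolvent) (k : Z) : fps :=
  (fps_const (r k) - fps_X * (fps_const (r k) * (res_a s k + res_a s (k + 1)))
   + fps_X * res_c s (k + 1))%S.

Definition res_step (p : cseq) (s : resolvent) : resolvent :=
  let B := res_step_B (fun k => fst (p k)) s in
  let c := res_step_c (fun k => snd (p k)) s in
  Resolvent (fun k => B k * c k + fps_X * (res_a s k * res_a s k))%S B c.

(** Each application of [res_step] fixes one more coefficient, whatever the
    starting point. *)
Definition res_approx (p : cseq) (n : nat) : resolvent :=
  Nat.iter n (res_step p) (Resolvent (fun _ => 0%S) (fun _ => 0%S) (fun _ => 0%S)).

Definition res (p : cseq) : resolvent :=
  Resolvent (fun k n => res_a (res_approx p (S n)) k n)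
            (fun k n => res_B (res_approx p (S n)) k n)
            (fun k n => res_c (res_approx p (S n)) k n).

Definition eq_below (n : nat) (f g : fps) : Prop := forall i, (i < n)%nat -> f i = g i.

Lemma eq_below_add n f f' g g' : eq_below n f f' -> eq_below n g g' ->
  eq_below n (f + g)%S (f' + g')%S.
Proof. intros Hf Hg i Hi; unfold fps_add; now rewrite Hf, Hg. Qed.

Lemma eq_below_sub n f f' g g' : eq_below n f f' -> eq_below n g g' ->
  eq_below n (f - g)%S (f' - g')%S.
Proof. intros Hf Hg i Hi; unfold fps_sub; now rewrite Hf, Hg. Qed.

Lemma eq_below_mul n f f' g g' : eq_below n f f' -> eq_below n g g' ->
  eq_below n (f * g)%S (f' * g')%S.
Proof.
intros Hf Hg i; revert f f' Hf; induction i as [|i IH]; intros f f' Hf Hi.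
- unfold fps_mul; simpl; now rewrite Hf, Hg.
- rewrite !fps_mul_S, Hf, Hg by lia; f_equal.
  assert (G : forall m h h', (forall j, (j <= m)%nat -> h j = h' j) ->
    (forall j, (j <= m)%nat -> g j = g' j) -> (h * g)%S m = (h' * g')%S m).
  { clear; induction m as [|m IH]; intros h h' Hh Hg.
    - unfold fps_mul; simpl; now rewrite Hh, Hg.
    - rewrite !fps_mul_S, Hh, Hg by lia; f_equal; apply IH; intros j Hj;
        [apply (Hh (S j))|apply Hg]; lia. }
  apply G; intros j Hj; [apply (Hf (S j))|apply Hg]; lia.
Qed.

Lemma eq_below_X_mul n f g : eq_below n f g -> eq_below (S n) (fps_X * f)%S (fps_X * g)%S.
Proof. intros H [|i] Hi; [now rewrite !fps_X_mul_O|]; rewrite !fps_X_mul_S; apply H; lia. Qed.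

Lemma eq_below_refl n f : eq_below n f f.
Proof. now intros i _. Qed.

Definition eq_res_below (n : nat) (s s' : resolvent) : Prop := forall k,
  eq_below n (res_a s k) (res_a s' k) /\ eq_below n (res_B s k) (res_B s' k) /\
  eq_below n (res_c s k) (res_c s' k).

Lemma res_step_contracts p n s s' :
  eq_res_below n s s' -> eq_res_below (S n) (res_step p s) (res_step p s').
Proof.
intros H.
assert (HB : forall k, eq_below (S n) (res_B (res_step p s) k) (res_B (res_step p s') k)).
{ intros k; apply eq_below_add; [apply eq_below_sub; [apply eq_below_refl|]|];
    apply eq_below_X_mul; [apply eq_below_mul; [apply eq_below_refl|apply eq_below_add]|]; apply H. }
assert (Hc : forall k, eq_below (S n) (res_c (res_step p s) k) (res_c (res_step p s') k)).
{ intros k; apply eq_below_add; [apply eq_below_sub; [apply eq_below_refl|]|];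
    apply eq_below_X_mul; [apply eq_below_mul; [apply eq_below_refl|apply eq_below_add]|]; apply H. }
intros k; split; [|split; [apply HB|apply Hc]].
apply eq_below_add; [apply eq_below_mul; [apply HB|apply Hc]|].
apply eq_below_X_mul, eq_below_mul; apply H.
Qed.

Lemma res_approx_stable p n m : (n <= m)%nat -> eq_res_below n (res_approx p n) (res_approx p m).
Proof.
revert m; induction n as [|n IH]; intros m Hm.
- intros k; repeat split; intros i Hi; lia.
- destruct m as [|m]; [lia|]; apply res_step_contracts, IH; lia.
Qed.

Lemma res_eq_approx p n : eq_res_below n (res p) (res_approx p n).
Proof.
intros k; repeat split; intros i Hi; simpl; apply (res_approx_stable p (S i) n Hi k); lia.
Qed.

(** The limit of the iteration: [res_step] is a contraction for the X-adic
    distance. *)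
Lemma res_fixpoint p : res p = res_step p (res p).
Proof.
assert (H : forall n, eq_res_below (S n) (res p) (res_step p (res p))).
{ intros n k; destruct (res_eq_approx p (S n) k) as (A & B & c).
  destruct (res_step_contracts p n _ _ (res_eq_approx p n) k) as (A' & B' & c').
  repeat split; intros i Hi.
  - rewrite A, A' by easy; reflexivity.
  - rewrite B, B' by easy; reflexivity.
  - rewrite c, c' by easy; reflexivity. }
destruct (res p) as [a B c] eqn:E, (res_step p (Resolvent a B c)) as [a' B' c'] eqn:E'.
f_equal; apply functional_extensionality; intros k; apply functional_extensionality; intros n;
  apply (H n k); lia.
Qed.

Section ResolventEquations.
Variable p : cseq.
Let q (k : Z) := fps_const (fst (p k)).
Let r (k : Z) := fps_const (snd (p k)).
Let a := res_a (res p).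
Let B := res_B (res p).
Let c := res_c (res p).

Lemma res_B_eq k : B (k + 1)%Z = (q k - fps_X * (q k * (a k + a (k + 1)%Z)) + fps_X * B k)%S.
Proof.
unfold B at 1; rewrite res_fixpoint; simpl; unfold res_step_B.
now replace (k + 1 - 1)%Z with k by ring.
Qed.

Lemma res_c_eq k : c k = (r k - fps_X * (r k * (a k + a (k + 1)%Z)) + fps_X * c (k + 1)%Z)%S.
Proof. unfold c at 1; now rewrite res_fixpoint. Qed.

Lemma res_a_eq k : a k = (B k * c k + fps_X * (a k * a k))%S.
Proof.
unfold a at 1, B, c; rewrite res_fixpoint at 1; simpl res_a at 1.
change (res_step_B (fun k => fst (p k)) (res p) k) with (res_B (res_step p (res p)) k).
change (res_step_c (fun k => snd (p k)) (res p) k) with (res_c (res_step p (res p)) k).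
now rewrite <- res_fixpoint.
Qed.

(** This relation is not one of the equations solved by iteration.  Subtracting
    the rank-one condition [res_a_eq] at two neighbouring sites gives it
    multiplied by the invertible series s = 1 - X (a_k + a_{k+1}). *)
Lemma res_diff k : (a (k + 1)%Z - a k)%S = (q k * c (k + 1)%Z - r k * B k)%S.
Proof.
set (s := (1 - fps_X * (a k + a (k + 1)%Z))%S).
set (e := (a (k + 1)%Z - a k - (q k * c (k + 1)%Z - r k * B k))%S).
assert (He : e = 0%S).
{ apply (fps_regular s).
  - unfold s, fps_sub; rewrite fps_X_mul_O; simpl.
    replace (1 - 0) with (RtoC 1) by ring; apply C1_nz.
  - transitivity ((a (k + 1)%Z - fps_X * (a (k + 1)%Z * a (k + 1)%Z))
      - (a k - fps_X * (a k * a k)) - (q k * c (k + 1)%Z - r k * B k) * s)%S;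
      [unfold e, s; ring|].
    rewrite (res_a_eq (k + 1)) at 1; rewrite (res_a_eq k) at 1.
    rewrite (res_B_eq k) at 1; rewrite (res_c_eq k) at 1; unfold s; ring. }
transitivity (e + (q k * c (k + 1)%Z - r k * B k))%S; [unfold e|rewrite He]; ring.
Qed.

Lemma res_X_diff k :
  (fps_X * a (k + 1)%Z - fps_X * a k)%S = (q k * c k - r k * B (k + 1)%Z)%S.
Proof.
transitivity (fps_X * (q k * c (k + 1)%Z - r k * B k))%S; [rewrite <- res_diff; ring|].
rewrite (res_B_eq k), (res_c_eq k); ring.
Qed.

End ResolventEquations.

(** * Differentiation along a line *)

Lemma locally_C_ball (P : C -> Prop) (d : R) :
  (0 < d)%R -> (forall t : C, (Cmod t < d)%R -> P t) -> @locally (AbsRing_UniformSpace C_AbsRing) (RtoC 0) P.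
Proof.
intros Hd H; exists (mkposreal d Hd); intros t Ht; apply H.
change (Cmod (Cminus t 0) < d)%R in Ht.
now replace (Cminus t 0) with t in Ht by (unfold Cminus; destruct t; unfold Cplus, Copp, RtoC; simpl; f_equal; ring).
Qed.

Lemma is_derive_quadratic (f : C -> C) (d : C) (delta M : R) :
  (0 < delta)%R ->
  (forall t, (Cmod t <= delta)%R -> (Cmod (f t - f 0 - t * d) <= Cmod t ^ 2 * M)%R) ->
  @is_derive C_AbsRing C_NormedModule f (RtoC 0) d.
Proof.
intros Hd H; split; [apply is_linear_scal_l|].
intros x Hx eps.
assert (x = RtoC 0) as -> by (symmetry; now apply is_filter_lim_locally_unique).
set (K := (Rabs M + 1)%R).
assert (HK : (0 < K)%R) by (unfold K; pose proof (Rabs_pos M); lra).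
assert (HM : (M <= K)%R) by (unfold K; pose proof (Rle_abs M); lra).
apply (locally_C_ball _ (Rmin delta (eps / K))).
- apply Rmin_pos; [easy|]; apply Rdiv_lt_0_compat; [apply cond_pos|easy].
- intros t Ht.
  change (Cmod (f t - f 0 - (t - 0) * d) <= eps * Cmod (t - 0))%R.
  replace (t - 0) with t by ring.
  assert (H1 : (Cmod t <= delta)%R) by (eapply Rle_trans; [left; exact Ht|apply Rmin_l]).
  assert (H2 : (Cmod t <= eps / K)%R) by (eapply Rle_trans; [left; exact Ht|apply Rmin_r]).
  eapply Rle_trans; [now apply H|].
  pose proof (Cmod_ge_0 t).
  assert (Cmod t * K <= eps)%R.
  { apply Rle_trans with (eps / K * K)%R; [apply Rmult_le_compat_r; lra|]; right; field; lra. }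
  replace (Cmod t ^ 2 * M)%R with (Cmod t * (Cmod t * M))%R by ring.
  rewrite (Rmult_comm eps); apply Rmult_le_compat_l; [easy|].
  apply Rle_trans with (Cmod t * K)%R; [apply Rmult_le_compat_l; lra|easy].
Qed.

(** Term by term differentiation: the remainders of order t^2 are summable with
    a bound uniform in [t]. *)
Lemma is_derive_sum_Z (f : C -> Z -> C) (d : Z -> C) (delta M : R) :
  (0 < delta)%R -> decay2 (f 0) -> decay2 d ->
  (forall t k, (Cmod t <= delta)%R ->
    ((1 + IZR (Z.abs k)) ^ 2 * Cmod (f t k - f 0 k - t * d k) <= Cmod t ^ 2 * M)%R) ->
  @is_derive C_AbsRing C_NormedModule (fun t => sum_Z (f t)) (RtoC 0) (sum_Z d).
Proof.
intros Hd H0 H1 H; apply (is_derive_quadratic _ _ delta (4 * (M * inv_square_sum)) Hd).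
intros t Ht.
destruct (sum_Z_bound (fun k => f t k - f 0 k - t * d k) (Cmod t ^ 2 * M)) as [E1 E2].
{ intros k; now apply H. }
replace (sum_Z (f t) - sum_Z (f 0) - t * sum_Z d) with (sum_Z (fun k => f t k - f 0 k - t * d k)).
- eapply Rle_trans; [exact E2|]; right; ring.
- assert (sum_Z (f t) = 1 * sum_Z (fun k => f t k - f 0 k - t * d k) + 1 * sum_Z (fun k => 1 * f 0 k + t * d k)) as ->.
  { apply is_sum_Z_unique.
    replace (f t) with (fun k => 1 * (f t k - f 0 k - t * d k) + 1 * (1 * f 0 k + t * d k)) at 1
      by (apply functional_extensionality; intros k; ring).
    apply is_sum_Z_lin; [exact E1|].
    apply sum_Z_correct, decay2_lin; [exact H0|exact H1]. }
  rewrite (sum_Z_lin (f 0) d 1 t) by easy; ring.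
Qed.

(** First order expansion in the parameter, uniform in the site. *)
Definition jet (f : C -> Z -> C) (d : Z -> C) : Prop :=
  rapidC (f 0) /\ rapidC d /\ exists e, uniformly_rapid e /\
    forall t k, f t k = f 0 k + t * d k + t * t * e t k.

Lemma jet_plus f f' d d' : jet f d -> jet f' d' ->
  jet (fun t k => f t k + f' t k) (fun k => d k + d' k).
Proof.
intros (A & B & e & He & H) (A' & B' & e' & He' & H').
split; [now apply rapidC_plus|]; split; [now apply rapidC_plus|].
exists (fun t k => e t k + e' t k); split; [now apply uniformly_rapid_plus|].
intros t k; rewrite H, H'; ring.
Qed.

Lemma jet_scal x f d : jet f d -> jet (fun t k => x * f t k) (fun k => x * d k).
Proof.
intros (A & B & e & He & H).
split; [now apply rapidC_scal|]; split; [now apply rapidC_scal|].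
exists (fun t k => x * e t k); split; [now apply uniformly_rapid_scal|].
intros t k; rewrite H; ring.
Qed.

Lemma jet_mult f f' d d' : jet f d -> jet f' d' ->
  jet (fun t k => f t k * f' t k) (fun k => d k * f' 0 k + f 0 k * d' k).
Proof.
intros (A & B & e & He & H) (A' & B' & e' & He' & H').
split; [now apply rapidC_mult|].
split; [apply rapidC_plus; now apply rapidC_mult|].
exists (fun t k => f 0 k * e' t k + e t k * f' 0 k + d k * d' k
  + t * (d k * e' t k + e t k * d' k) + t * (t * (e t k * e' t k))); split.
- repeat apply uniformly_rapid_plus; repeat apply uniformly_rapid_param;
    repeat apply uniformly_rapid_plus; now apply uniformly_rapid_mult.
- intros t k; rewrite (H t k), (H' t k); ring.
Qed.

Lemma jet_translate j f d : jet f d -> jet (fun t k => f t (k + j)%Z) (fun k => d (k + j)%Z).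
Proof.
intros (A & B & e & He & H).
split; [now apply (rapidC_translate j)|]; split; [now apply (rapidC_translate j)|].
exists (fun t k => e t (k + j)%Z); split; [now apply uniformly_rapid_translate|].
intros t k; apply H.
Qed.

Lemma jet_0 : jet (fun _ _ => 0) (fun _ => 0).
Proof.
split; [apply rapidC_0|]; split; [apply rapidC_0|].
exists (fun _ _ => 0); split; [apply rapidC_0|]; intros; ring.
Qed.

Lemma jet_line f v : rapidC f -> rapidC v -> jet (fun t k => f k + t * v k) v.
Proof.
intros Hf Hv; split; [|split; [easy|]].
- apply (rapidC_ext f (fun k => f k + 0 * v k)); [intros; ring|easy].
- exists (fun _ _ => 0); split; [apply rapidC_0|]; intros; ring.
Qed.

Lemma jet_sum_Z f d : jet f d ->
  @is_derive C_AbsRing C_NormedModule (fun t => sum_Z (f t)) (RtoC 0) (sum_Z d).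
Proof.
intros (A & B & e & He & H).
destruct (He 2%nat) as [M HM].
apply (is_derive_sum_Z f d 1 M); [lra|now apply rapidC_decay2|now apply rapidC_decay2|].
intros t k Ht; replace (f t k - f 0 k - t * d k) with (t * t * e t k) by (rewrite (H t k); ring).
rewrite !Cmod_mult.
replace ((1 + IZR (Z.abs k)) ^ 2 * (Cmod t * Cmod t * Cmod (e t k)))%R
  with (Cmod t ^ 2 * ((1 + IZR (Z.abs k)) ^ 2 * Cmod (e t k)))%R by ring.
apply Rmult_le_compat_l; [apply pow2_ge_0|now apply HM].
Qed.

(** The linear coefficient is determined, so relations between families can be
    differentiated by comparing two expansions. *)
Lemma jet_derive f d : jet f d -> forall k, d k = C_derive (fun t => f t k) 0.
Proof.
intros (A & B & e & He & H) k; symmetry; apply is_C_derive_unique.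
destruct (uniformly_rapid_bounded e He) as [K HK].
apply (is_derive_quadratic _ _ 1 K); [lra|]; intros t Ht.
replace (f t k - f 0 k - t * d k) with (t * t * e t k) by (rewrite (H t k); ring).
rewrite !Cmod_mult; simpl; rewrite Rmult_1_r; apply Rmult_le_compat_l;
  [apply Rmult_le_pos; apply Cmod_ge_0|now apply HK].
Qed.

Definition fps_jet (F : C -> Z -> fps) (D : Z -> fps) : Prop :=
  forall n, jet (fun t k => F t k n) (fun k => D k n).

Lemma fps_jet_unique F D D' : fps_jet F D -> fps_jet F D' -> forall k, D k = D' k.
Proof.
intros H H' k; apply functional_extensionality; intros n.
now rewrite (jet_derive _ _ (H n) k), (jet_derive _ _ (H' n) k).
Qed.

Lemma fps_jet_ext F F' D : (forall t k, F t k = F' t k) -> fps_jet F D -> fps_jet F' D.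
Proof.
intros H HF; replace F' with F; [easy|].
apply functional_extensionality; intros t; apply functional_extensionality; intros k; apply H.
Qed.

Lemma jet_ext f d d' : (forall k, d k = d' k) -> jet f d -> jet f d'.
Proof. intros H; now replace d' with d by (now apply functional_extensionality). Qed.

Lemma fps_jet_add F F' D D' : fps_jet F D -> fps_jet F' D' ->
  fps_jet (fun t k => F t k + F' t k)%S (fun k => D k + D' k)%S.
Proof. intros H H' n; exact (jet_plus _ _ _ _ (H n) (H' n)). Qed.

Lemma fps_jet_sub F F' D D' : fps_jet F D -> fps_jet F' D' ->
  fps_jet (fun t k => F t k - F' t k)%S (fun k => D k - D' k)%S.
Proof.
intros H H' n.
replace (fun t k => (F t k - F' t k)%S n) with (fun t k => F t k n + (-1) * F' t k n).
- apply (jet_ext _ (fun k => D k n + (-1) * D' k n)); [intros k; unfold fps_sub; ring|].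
  apply jet_plus; [apply H|apply jet_scal, H'].
- apply functional_extensionality; intros t; apply functional_extensionality; intros k.
  unfold fps_sub; ring.
Qed.

Lemma fps_jet_mul F F' D D' : fps_jet F D -> fps_jet F' D' ->
  fps_jet (fun t k => F t k * F' t k)%S (fun k => D k * F' (RtoC 0) k + F (RtoC 0) k * D' k)%S.
Proof.
intros H H' n; revert F D H; induction n as [|n IH]; intros F D H.
- apply (jet_mult _ _ _ _ (H O) (H' O)).
- specialize (IH (fun t k => fps_tail (F t k)) (fun k => fps_tail (D k)) (fun m => H (S m))).
  apply (jet_ext _ _ (fun k => (D k * F' (RtoC 0) k + F (RtoC 0) k * D' k)%S (S n))) with
    (2 := jet_plus _ _ _ _ (jet_mult _ _ _ _ (H O) (H' (S n))) IH).
  intros k; unfold fps_add; rewrite !fps_mul_S; ring.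
Qed.

Lemma fps_jet_X_mul F D : fps_jet F D ->
  fps_jet (fun t k => fps_X * F t k)%S (fun k => fps_X * D k)%S.
Proof.
intros H [|n].
- replace (fun (t : C) (k : Z) => (fps_X * F t k)%S O) with (fun (_ : C) (_ : Z) => RtoC 0).
  + apply (jet_ext _ (fun _ => 0)); [intros k; now rewrite fps_X_mul_O|apply jet_0].
  + apply functional_extensionality; intros t; apply functional_extensionality; intros k.
    now rewrite fps_X_mul_O.
- replace (fun (t : C) (k : Z) => (fps_X * F t k)%S (S n)) with (fun t k => F t k n).
  + apply (jet_ext _ (fun k => D k n)); [intros k; now rewrite fps_X_mul_S|apply H].
  + apply functional_extensionality; intros t; apply functional_extensionality; intros k.
    now rewrite fps_X_mul_S.
Qed.

Lemma fps_jet_translate j F D : fps_jet F D ->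
  fps_jet (fun t k => F t (k + j)%Z) (fun k => D (k + j)%Z).
Proof. intros H n; exact (jet_translate j _ _ (H n)). Qed.

Lemma fps_jet_const f d : jet f d ->
  fps_jet (fun t k => fps_const (f t k)) (fun k => fps_const (d k)).
Proof. intros H [|n]; [exact H|exact jet_0]. Qed.

Section Expansion.
Variables p v : cseq.
Hypotheses (Hp : rapid p) (Hv : rapid v).

Definition res_jet (s : C -> resolvent) (D : resolvent) : Prop :=
  fps_jet (fun t => res_a (s t)) (res_a D) /\ fps_jet (fun t => res_B (s t)) (res_B D) /\
  fps_jet (fun t => res_c (s t)) (res_c D).

Lemma jet_q : jet (fun t k => fst (shift p t v k)) (fun k => fst (v k)).
Proof. apply rapid_iff in Hp, Hv; simpl; now apply jet_line. Qed.

Lemma jet_r : jet (fun t k => snd (shift p t v k)) (fun k => snd (v k)).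
Proof. apply rapid_iff in Hp, Hv; simpl; now apply jet_line. Qed.

Lemma res_step_B_jet s D : res_jet s D ->
  exists E, fps_jet (fun t => res_step_B (fun k => fst (shift p t v k)) (s t)) E.
Proof.
intros (Ha & HB & Hc); eexists; unfold res_step_B.
pose proof (fps_jet_const _ _ (jet_translate (-1) _ _ jet_q)) as Hq.
apply (fps_jet_add _ _ _ _
  (fps_jet_sub _ _ _ _ Hq
    (fps_jet_X_mul _ _ (fps_jet_mul _ _ _ _ Hq
      (fps_jet_add _ _ _ _ (fps_jet_translate (-1) _ _ Ha) Ha))))
  (fps_jet_X_mul _ _ (fps_jet_translate (-1) _ _ HB))).
Qed.

Lemma res_step_c_jet s D : res_jet s D ->
  exists E, fps_jet (fun t => res_step_c (fun k => snd (shift p t v k)) (s t)) E.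
Proof.
intros (Ha & HB & Hc); eexists; unfold res_step_c.
pose proof (fps_jet_const _ _ jet_r) as Hr.
apply (fps_jet_add _ _ _ _
  (fps_jet_sub _ _ _ _ Hr
    (fps_jet_X_mul _ _ (fps_jet_mul _ _ _ _ Hr
      (fps_jet_add _ _ _ _ Ha (fps_jet_translate 1 _ _ Ha)))))
  (fps_jet_X_mul _ _ (fps_jet_translate 1 _ _ Hc))).
Qed.

Lemma res_approx_jet n : exists D, res_jet (fun t => res_approx (shift p t v) n) D.
Proof.
induction n as [|n [D HD]].
- exists (Resolvent (fun _ => 0%S) (fun _ => 0%S) (fun _ => 0%S)).
  assert (H : fps_jet (fun _ _ => 0%S) (fun _ => 0%S)) by (intros [|n]; exact jet_0).
  repeat split; apply H.
- destruct (res_step_B_jet _ _ HD) as [EB HB], (res_step_c_jet _ _ HD) as [Ec Hc].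
  destruct HD as (Ha & _ & _).
  eexists (Resolvent _ EB Ec); split; [|now split].
  exact (fps_jet_add _ _ _ _ (fps_jet_mul _ _ _ _ HB Hc)
    (fps_jet_X_mul _ _ (fps_jet_mul _ _ _ _ Ha Ha))).
Qed.

(** Every coefficient of the resolvent is already a coefficient of some
    [res_approx], which is obtained from (q, r) by finitely many sums, products
    and translations. *)
Lemma res_has_jet : exists D, res_jet (fun t => res (shift p t v)) D.
Proof.
assert (H : forall F : C -> Z -> fps, (forall n, exists d, jet (fun t k => F t k n) d) ->
  fps_jet F (fun k n => C_derive (fun t => F t k n) 0)).
{ intros F HF n; destruct (HF n) as [d Hd].
  exact (jet_ext _ _ _ (jet_derive _ _ Hd) Hd). }
eexists (Resolvent _ _ _); split; [|split]; apply H; intros n;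
  destruct (res_approx_jet (S n)) as (D & Ha & HB & Hc); eexists;
  [apply (Ha n)|apply (HB n)|apply (Hc n)].
Qed.
End Expansion.

(** * Variation of the conserved densities *)

(** tr (P [x, y]) / X for P = [[X a, B], [X c, 1 - X a]] and two trace-free
    matrices x = [[X xa, xB], [X xc, - X xa]] and y of the same form: the
    curvature of the family of projectors in the directions x and y. *)
Definition curvature (a B c xa xB xc ya yB yc : fps) : fps :=
  (((1 + 1) * fps_X * a - 1) * (xB * yc - xc * yB)
   + (1 + 1) * fps_X * (c * (xa * yB - xB * ya) + B * (xc * ya - xa * yc)))%S.

(** The closedness identity at one site, for two derivations.  The first one
    (prefix x) annihilates X; it is the variation of (q, r).  The second one
    (prefix y) annihilates q and r and maps X to itself; it is X d/dX, which
    accounts for the terms a + ya and c + yc: they are the variations of X a and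
    X c, divided by X.  Primes denote the site k + 1.

    The factor 1 - q r clears the denominator of U^{-1}.  Once a', B',
    c and their variations are eliminated, the only relation left is the rank-one
    condition N = 0 together with its two derivatives Nx = 0 and Ny = 0, and the
    difference of the two sides is an explicit combination of N, Nx, Ny. *)
Lemma curvature_transport (q r a a' B B' c c' xq xr xa xa' xB xB' xc xc'
    ya ya' yB yB' yc yc' : fps) :
  (a = B * c + fps_X * (a * a) ->
   a' = a + (q * c' - r * B) ->
   B' = q - fps_X * (q * (a + a')) + fps_X * B ->
   c = r - fps_X * (r * (a + a')) + fps_X * c' ->
   xa = xB * c + B * xc + fps_X * (xa * a + a * xa) ->
   xa' = xa + (xq * c' + q * xc' - (xr * B + r * xB)) ->
   xB' = xq - fps_X * (xq * (a + a') + q * (xa + xa')) + fps_X * xB ->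
   xc = xr - fps_X * (xr * (a + a') + r * (xa + xa')) + fps_X * xc' ->
   ya = yB * c + B * yc + fps_X * (a * a) + fps_X * (ya * a + a * ya) ->
   ya' = ya + (q * yc' - r * yB) ->
   yB' = fps_X * B + fps_X * yB - (fps_X * (q * (a + a')) + fps_X * (q * (ya + ya'))) ->
   yc = fps_X * c' + fps_X * yc' - (fps_X * (r * (a + a')) + fps_X * (r * (ya + ya'))) ->
   (1 - q * r) * (xa - (curvature a' B' c' xa' xB' xc' (a' + ya') yB' (c' + yc')
                       - curvature a B c xa xB xc (a + ya) yB (c + yc)))
   = (B - q * a) * xr + (c' - r * a') * xq + ((yB - q * ya) * xr + (yc' - r * ya') * xq))%S.
Proof.
intros Ha -> -> Hc Hxa -> -> Hxc Hya -> -> Hyc.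
set (N := (a - (B * c + fps_X * (a * a)))%S).
set (Nx := (xa - (xB * c + B * xc + fps_X * (xa * a + a * xa)))%S).
set (Ny := (ya - (yB * c + B * yc + fps_X * (a * a) + fps_X * (ya * a + a * ya)))%S).
assert (HN : N = 0%S) by (unfold N; rewrite <- Ha; ring).
assert (HNx : Nx = 0%S) by (unfold Nx; rewrite <- Hxa; ring).
assert (HNy : Ny = 0%S) by (unfold Ny; rewrite <- Hya; ring).
(* The coefficients of N, Nx and Ny below come from solving a linear system
   for polynomials of low degree, one for each monomial in the variations. *)
set (V := (q * r * xq * yc' - q * r * xa + q * xr * ya - r * r * xq * yB + r * xq * ya
  - xq * yc' - xr * yB + xa)%S).
set (W := (q * r * c' * xq + q * a * xr - r * r * B * xq + r * a * xq - B * xr - c' * xq)%S).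
match goal with |- _ = ?rhs => transitivity (rhs
  + (q * xr + r * xq + (1 + 1) * fps_X * ((1 + 1) * V + W)) * N
  + (1 - (1 + 1) * fps_X * a) * (1 - q * r) * Nx
  + (q * xr + r * xq - (1 + 1) * fps_X * W) * Ny)%S end.
- clear HN HNx HNy Ha Hxa Hya; unfold N, Nx, Ny, V, W, curvature; subst yc xc c; ring.
- rewrite HN, HNx, HNy; ring.
Qed.

Definition fps_rapid (F : Z -> fps) : Prop := forall n, rapidC (fun k => F k n).

(** A family that does not depend on the parameter is a special case of a jet;
    the product rule for jets then gives the stability of rapid decay under
    products of series. *)
Lemma fps_rapid_jet F : fps_rapid F -> fps_jet (fun _ => F) (fun _ => 0%S).
Proof.
intros H n; split; [apply H|]; split.
- apply (rapidC_ext (fun _ => 0)); [intros; now destruct n|apply rapidC_0].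
- exists (fun _ _ => 0); split; [apply rapidC_0|]; intros t k; destruct n; simpl; ring.
Qed.

Lemma fps_rapid_add F G : fps_rapid F -> fps_rapid G -> fps_rapid (fun k => F k + G k)%S.
Proof. intros HF HG n; exact (rapidC_plus _ _ (HF n) (HG n)). Qed.

Lemma fps_rapid_sub F G : fps_rapid F -> fps_rapid G -> fps_rapid (fun k => F k - G k)%S.
Proof. intros HF HG n; exact (rapidC_minus _ _ (HF n) (HG n)). Qed.

Lemma fps_rapid_mul F G : fps_rapid F -> fps_rapid G -> fps_rapid (fun k => F k * G k)%S.
Proof.
intros HF HG n.
destruct (fps_jet_mul _ _ _ _ (fps_rapid_jet _ HF) (fps_rapid_jet _ HG) n) as [H _]; exact H.
Qed.

Lemma fps_rapid_X_mul F : fps_rapid F -> fps_rapid (fun k => fps_X * F k)%S.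
Proof.
intros HF n; destruct (fps_jet_X_mul _ _ (fps_rapid_jet _ HF) n) as [H _]; exact H.
Qed.

Lemma fps_rapid_euler F : fps_rapid F -> fps_rapid (fun k => fps_euler (F k)).
Proof. intros HF n; exact (rapidC_scal _ _ (HF n)). Qed.

Lemma fps_rapid_ext F G : (forall k, F k = G k) -> fps_rapid F -> fps_rapid G.
Proof. intros H HF; now replace G with F by (now apply functional_extensionality). Qed.

Lemma curvature_rapid a B c xa xB xc ya yB yc :
  fps_rapid a -> fps_rapid B -> fps_rapid c -> fps_rapid xa -> fps_rapid xB -> fps_rapid xc ->
  fps_rapid ya -> fps_rapid yB -> fps_rapid yc ->
  fps_rapid (fun k => curvature (a k) (B k) (c k) (xa k) (xB k) (xc k) (ya k) (yB k) (yc k)).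
Proof.
intros Ha HB Hc Hxa HxB Hxc Hya HyB Hyc.
apply (fps_rapid_ext (fun k =>
  fps_X * ((a k + a k) * (xB k * yc k - xc k * yB k)) - (xB k * yc k - xc k * yB k)
  + fps_X * (c k * (xa k * yB k - xB k * ya k) + B k * (xc k * ya k - xa k * yc k)
     + (c k * (xa k * yB k - xB k * ya k) + B k * (xc k * ya k - xa k * yc k))))%S).
- intros k; unfold curvature; ring.
- repeat first [assumption | apply fps_rapid_sub | apply fps_rapid_add
    | apply fps_rapid_X_mul | apply fps_rapid_mul].
Qed.

Lemma shift_0 p v : shift p 0 v = p.
Proof.
apply functional_extensionality; intros k; unfold shift.
destruct (p k) as [x y]; simpl; f_equal; ring.
Qed.

(** The field Y_{m+1}: the coefficient of X^m in the components of
    (1 - q r) tr (P U^{-1} delta U) / X along delta q and delta r. *)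
Definition res_field (p : cseq) (m : nat) : cseq := fun k =>
  (res_c (res p) (k + 1) m - snd (p k) * res_a (res p) (k + 1) m,
   res_B (res p) k m - fst (p k) * res_a (res p) k m).

Definition hamiltonian (m : nat) : functional := fun p =>
  sum_Z (fun k => / RtoC (INR (S m)) * res_a (res p) k m).

(** The differential in the direction [v] of a functional whose gradient is
    [gradient_of Y]. *)
Definition pairing (p Y v : cseq) : C :=
  sum_Z (fun k => (fst (Y k) * fst (v k) + snd (Y k) * snd (v k)) / (1 - fst (p k) * snd (p k))).

Section Variation.
Variables p v : cseq.
Hypotheses (Hp : phase_space p) (Hv : rapid v).
Let q k := fps_const (fst (p k)).
Let r k := fps_const (snd (p k)).
Let xq k := fps_const (fst (v k)).
Let xr k := fps_const (snd (v k)).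
Let a := res_a (res p).
Let B := res_B (res p).
Let c := res_c (res p).

(** Away from the divergence of the curvature, the variation of a is
    (1 + X d/dX) applied to the trace form: the variations of q and r are
    constant in X, so the derivation X d/dX meets only B, a and c. *)
Lemma density_variation : exists D : resolvent,
  fps_jet (fun t => res_a (res (shift p t v))) (res_a D) /\
  exists Om : Z -> fps, fps_rapid Om /\ forall k,
  ((1 - q k * r k) * (res_a D k - (Om (k + 1)%Z - Om k)) =
    (B k - q k * a k) * xr k + (c (k + 1)%Z - r k * a (k + 1)%Z) * xq k
    + fps_euler ((B k - q k * a k) * xr k + (c (k + 1)%Z - r k * a (k + 1)%Z) * xq k))%S.
Proof.
destruct Hp as [Hpr _].
destruct (res_has_jet p v Hpr Hv) as [D (Da & DB & Dc)].
exists D; split; [exact Da|].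
pose proof (fps_jet_const _ _ (jet_q p v Hpr Hv)) as Dq.
pose proof (fps_jet_const _ _ (jet_r p v Hpr Hv)) as Dr.
set (xa := res_a D) in *; set (xB := res_B D) in *; set (xc := res_c D) in *.
set (y := fun f : Z -> fps => fun k => fps_euler (f k)).
pose proof (fps_jet_translate 1 _ _ Da) as Da'.
pose proof (fps_jet_translate 1 _ _ DB) as DB'.
pose proof (fps_jet_translate 1 _ _ Dc) as Dc'.
assert (Ra : fps_rapid a) by (intros n; destruct (Da n) as [H _]; now rewrite shift_0 in H).
assert (RB : fps_rapid B) by (intros n; destruct (DB n) as [H _]; now rewrite shift_0 in H).
assert (Rc : fps_rapid c) by (intros n; destruct (Dc n) as [H _]; now rewrite shift_0 in H).
assert (Rxa : fps_rapid xa) by (intros n; destruct (Da n) as (_ & H & _); exact H).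
assert (RxB : fps_rapid xB) by (intros n; destruct (DB n) as (_ & H & _); exact H).
assert (Rxc : fps_rapid xc) by (intros n; destruct (Dc n) as (_ & H & _); exact H).
exists (fun k => curvature (a k) (B k) (c k) (xa k) (xB k) (xc k) (a k + y a k) (y B k) (c k + y c k))%S.
split.
{ apply curvature_rapid; try assumption; unfold y; try apply fps_rapid_add; try apply fps_rapid_euler; assumption. }
intros k.
assert (Ea' : forall p k, res_a (res p) (k + 1)%Z = (res_a (res p) k +
  (fps_const (fst (p k)) * res_c (res p) (k + 1)%Z - fps_const (snd (p k)) * res_B (res p) k))%S).
{ intros p' k'; rewrite <- res_diff; ring. }
rewrite (curvature_transport (q k) (r k) (a k) (a (k + 1)%Z) (B k) (B (k + 1)%Z) (c k) (c (k + 1)%Z)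
  (xq k) (xr k) (xa k) (xa (k + 1)%Z) (xB k) (xB (k + 1)%Z) (xc k) (xc (k + 1)%Z)
  (y a k) (y a (k + 1)%Z) (y B k) (y B (k + 1)%Z) (y c k) (y c (k + 1)%Z)).
- unfold y, q, r, xq, xr; rewrite !fps_euler_add, !fps_euler_mul, !fps_euler_sub, !fps_euler_mul,
    !fps_euler_const; ring.
- apply res_a_eq.
- apply Ea'.
- apply res_B_eq.
- apply res_c_eq.
- pose proof (fps_jet_add _ _ _ _ (fps_jet_mul _ _ _ _ DB Dc) (fps_jet_X_mul _ _ (fps_jet_mul _ _ _ _ Da Da))) as H.
  refine (eq_trans (fps_jet_unique _ _ _ Da (fps_jet_ext _ _ _
    (fun t k => eq_sym (res_a_eq (shift p t v) k)) H) k) _).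
  cbv beta; rewrite shift_0; reflexivity.
- pose proof (fps_jet_add _ _ _ _ Da (fps_jet_sub _ _ _ _
    (fps_jet_mul _ _ _ _ Dq Dc') (fps_jet_mul _ _ _ _ Dr DB))) as H.
  refine (eq_trans (fps_jet_unique _ _ _ Da' (fps_jet_ext _ _ _
    (fun t k => eq_sym (Ea' (shift p t v) k)) H) k) _).
  cbv beta; rewrite shift_0; reflexivity.
- pose proof (fps_jet_add _ _ _ _ (fps_jet_sub _ _ _ _ Dq (fps_jet_X_mul _ _
    (fps_jet_mul _ _ _ _ Dq (fps_jet_add _ _ _ _ Da Da')))) (fps_jet_X_mul _ _ DB)) as H.
  refine (eq_trans (fps_jet_unique _ _ _ DB' (fps_jet_ext _ _ _
    (fun t k => eq_sym (res_B_eq (shift p t v) k)) H) k) _).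
  cbv beta; rewrite shift_0; reflexivity.
- pose proof (fps_jet_add _ _ _ _ (fps_jet_sub _ _ _ _ Dr (fps_jet_X_mul _ _
    (fps_jet_mul _ _ _ _ Dr (fps_jet_add _ _ _ _ Da Da')))) (fps_jet_X_mul _ _ Dc')) as H.
  refine (eq_trans (fps_jet_unique _ _ _ Dc (fps_jet_ext _ _ _
    (fun t k => eq_sym (res_c_eq (shift p t v) k)) H) k) _).
  cbv beta; rewrite shift_0; reflexivity.
- unfold y at 1, a at 1; rewrite res_a_eq; fold a B c.
  rewrite fps_euler_add, !fps_euler_mul, fps_euler_X; unfold y; ring.
- unfold y at 1, a at 1; rewrite Ea'; fold a B c.
  rewrite fps_euler_add, fps_euler_sub, !fps_euler_mul, !fps_euler_const; unfold y, q, r; ring.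
- unfold y at 1, B at 1; rewrite res_B_eq; fold a B c.
  rewrite fps_euler_add, fps_euler_sub, !fps_euler_mul, fps_euler_add, !fps_euler_const, fps_euler_X;
    unfold y, q, r; ring.
- unfold y at 1, c at 1; rewrite res_c_eq; fold a B c.
  rewrite fps_euler_add, fps_euler_sub, !fps_euler_mul, fps_euler_add, !fps_euler_const, fps_euler_X;
    unfold y, q, r; ring.
Qed.

Lemma one_minus_qr_neq_0 k : 1 - fst (p k) * snd (p k) <> 0.
Proof. destruct Hp as [_ H]; intros E; apply (H k); rewrite <- E; ring. Qed.

(** On the coefficient of X^m the operator 1 + X d/dX is multiplication by
    m + 1, which the normalisation of [hamiltonian] cancels; the curvature
    disappears by telescoping. *)
Lemma hamiltonian_derive m :
  @is_derive C_AbsRing C_NormedModule (fun t => hamiltonian m (shift p t v)) (RtoC 0)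
    (pairing p (res_field p m) v).
Proof.
destruct density_variation as (D & Da & Om & HOm & H).
set (x := / RtoC (INR (S m))).
pose proof (jet_scal x _ _ (Da m)) as Hj.
replace (pairing p (res_field p m) v) with (sum_Z (fun k => x * res_a D k m)).
- exact (jet_sum_Z _ _ Hj).
- set (T := fun k => x * (Om (k + 1)%Z m) - x * Om k m).
  assert (HT : rapidC (fun k => x * Om k m)) by (apply rapidC_scal, HOm).
  transitivity (1 * sum_Z (fun k => x * res_a D k m) + (-1) * sum_Z T).
  + rewrite (sum_Z_telescope T (fun k => x * Om k m)) by easy; ring.
  + rewrite <- sum_Z_lin.
    * apply sum_Z_ext; intros k; unfold T.
      assert (Hm : RtoC (INR (S m)) <> 0).
      { intros E; apply RtoC_inj in E; revert E; apply not_0_INR; lia. }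
      pose proof (one_minus_qr_neq_0 k) as Hk.
      assert (E : (1 - fst (p k) * snd (p k)) * (res_a D k m - (Om (k + 1)%Z m - Om k m))
        = RtoC (INR (S m)) * (fst (res_field p m k) * fst (v k) + snd (res_field p m k) * snd (v k))).
      { specialize (H k); apply (f_equal (fun f : fps => f m)) in H.
        replace ((1 - q k * r k)%S) with (fps_const (1 - fst (p k) * snd (p k))) in H
          by (apply functional_extensionality; intros n; unfold q, r, fps_sub; rewrite fps_const_mul;
              destruct n; simpl; ring).
        rewrite fps_const_mul in H.
        unfold fps_sub at 1 2 in H; rewrite H; unfold fps_add, fps_euler.
        rewrite (fps_mulC _ (xr k)), (fps_mulC _ (xq k)).
        unfold xr, xq; rewrite !fps_const_mul.
        unfold fps_sub, q, r; rewrite !fps_const_mul, S_INR, RtoC_plus.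
        unfold res_field; cbn [fst snd]; fold a B c; ring. }
      transitivity (x * (res_a D k m - (Om (k + 1)%Z m - Om k m))); [ring|].
      apply (f_equal (fun z => x * z / (1 - fst (p k) * snd (p k)))) in E.
      unfold x in *; etransitivity; [|etransitivity; [exact E|]]; field; auto.
    * apply rapidC_decay2, Hj.
    * apply rapidC_decay2; unfold T; apply rapidC_minus; [apply (rapidC_translate 1 _ HT)|easy].
Qed.

End Variation.

(** * The recursion operators on telescoping sequences *)

(** Primitives for the summands of L and its inverse.  They also serve for L_-,
    whose summand t_j is the difference of the last two ones below. *)
Record potentials (p w : cseq) (sigma kappa rho : Z -> C) : Prop := {
  pot_sigma : rapidC sigma;
  pot_kappa : rapidC kappa;
  pot_rho : rapidC rho;
  pot_ssum : forall j, ssum p w j = sigma (j + 1)%Z - sigma j;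
  pot_L : forall j, fst (p j) * fst (w (j - 1)%Z) - snd (p j) * snd (w (j + 1)%Z)
    = kappa (j + 1)%Z - kappa j;
  pot_Linv : forall j, fst (p j) * fst (w (j + 1)%Z) - snd (p j) * snd (w (j - 1)%Z)
    = rho (j + 1)%Z - rho j }.

Definition opSum (p w : cseq) : cseq := cadd (opLplus p w) (opLminus p w).

(** The values of the three operators when the sums are replaced by boundary
   values of the potentials. *)
Definition local_L (p w : cseq) (sigma kappa : Z -> C) : cseq := fun k =>
  let q j := fst (p j) in let r j := snd (p j) in
  let u j := fst (w j) in let v j := snd (w j) in
  (u (k - 1)%Z + (1 - r k * q k) * r (k - 1)%Z * sigma k + r k * kappa k,
   v (k + 1)%Z + (1 - r k * q k) * q (k + 1)%Z * sigma (k + 1)%Z + q k * kappa (k + 1)%Z).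

Definition local_Linv (p w : cseq) (sigma rho : Z -> C) : cseq := fun k =>
  let q j := fst (p j) in let r j := snd (p j) in
  let u j := fst (w j) in let v j := snd (w j) in
  (u (k + 1)%Z - (1 - r k * q k) * r (k + 1)%Z * sigma (k + 1)%Z - r k * rho (k + 1)%Z,
   v (k - 1)%Z - (1 - r k * q k) * q (k - 1)%Z * sigma k - q k * rho k).

Definition local_Lminus (p w : cseq) (sigma kappa rho : Z -> C) : cseq := fun k =>
  let q j := fst (p j) in let r j := snd (p j) in
  let u j := fst (w j) in let v j := snd (w j) in
  let tau := rho (k + 1)%Z - kappa (k + 1)%Z in
  (u (k + 1)%Z + u (k - 1)%Z
     - (1 - r k * q k) * (r (k + 1)%Z * sigma (k + 1)%Z - r (k - 1)%Z * sigma k)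
     - r k * tau - r k * q k * u (k - 1)%Z + r k * r k * v (k + 1)%Z,
   v (k + 1)%Z + v (k - 1)%Z
     + (1 - r k * q k) * (q (k + 1)%Z * sigma (k + 1)%Z - q (k - 1)%Z * sigma k)
     - q k * tau + q k * q k * u (k + 1)%Z - q k * r k * v (k - 1)%Z).

Definition local_sum (p w : cseq) (sigma kappa rho : Z -> C) : cseq :=
  cadd (cadd (local_L p w sigma kappa) (local_Linv p w sigma rho))
       (local_Lminus p w sigma kappa rho).

Lemma opSum_local p w sigma kappa rho :
  potentials p w sigma kappa rho -> opSum p w = local_sum p w sigma kappa rho.
Proof.
intros [Hs Hk Hr Es Ek Er]; unfold opSum, local_sum, opLplus; repeat f_equal;
  apply functional_extensionality; intros k.
- unfold opL, local_L; cbv zeta.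
  rewrite !(sum_ge_telescope (ssum p w) sigma) by assumption.
  rewrite !(sum_ge_telescope _ kappa _ Hk Ek); f_equal; ring.
- unfold opLinv, local_Linv; cbv zeta.
  rewrite !(sum_ge_telescope (ssum p w) sigma) by assumption.
  rewrite !(sum_ge_telescope _ rho _ Hr Er); f_equal; ring.
- unfold opLminus, local_Lminus; cbv zeta.
  rewrite !(sum_le_telescope (ssum p w) sigma) by assumption.
  rewrite (sum_le_telescope _ (fun j => rho j - kappa j)).
  + replace (k - 1 + 1)%Z with k by ring; f_equal; ring.
  + now apply rapidC_minus.
  + intros j.
    replace (rho (j + 1)%Z - kappa (j + 1)%Z - (rho j - kappa j))
      with ((rho (j + 1)%Z - rho j) - (kappa (j + 1)%Z - kappa j)) by ring.
    rewrite <- Ek, <- Er; ring.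
Qed.

Definition telescoping (p w : cseq) : Prop :=
  exists sigma kappa rho, potentials p w sigma kappa rho.

Definition lin_comb (x y : C) (w z : cseq) : cseq := fun k =>
  (x * fst (w k) + y * fst (z k), x * snd (w k) + y * snd (z k)).

(** Potentials add up, so linearity holds on telescoping sequences without a
    separate discussion of convergence. *)
Lemma opSum_linear p x y w z : phase_space p -> telescoping p w -> telescoping p z ->
  telescoping p (lin_comb x y w z) /\ opSum p (lin_comb x y w z) = lin_comb x y (opSum p w) (opSum p z).
Proof.
intros [_ Hp] (s & k & r & Hw) (s' & k' & r' & Hz).
assert (H : potentials p (lin_comb x y w z) (fun j => x * s j + y * s' j)
  (fun j => x * k j + y * k' j) (fun j => x * r j + y * r' j)).
{ destruct Hw as [A1 A2 A3 A4 A5 A6], Hz as [B1 B2 B3 B4 B5 B6].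
  assert (G : forall f f', rapidC f -> rapidC f' -> rapidC (fun j => x * f j + y * f' j))
    by (intros; apply rapidC_plus; now apply rapidC_scal).
  split; auto; intros j; unfold lin_comb; cbn [fst snd].
  - transitivity (x * (s (j + 1)%Z - s j) + y * (s' (j + 1)%Z - s' j)); [|ring].
    rewrite <- A4, <- B4; unfold ssum; cbn [fst snd]; field; apply Hp.
  - transitivity (x * (k (j + 1)%Z - k j) + y * (k' (j + 1)%Z - k' j)); [|ring].
    rewrite <- A5, <- B5; ring.
  - transitivity (x * (r (j + 1)%Z - r j) + y * (r' (j + 1)%Z - r' j)); [|ring].
    rewrite <- A6, <- B6; ring. }
split; [now exists (fun j => x * s j + y * s' j), (fun j => x * k j + y * k' j), (fun j => x * r j + y * r' j)|].
rewrite (opSum_local _ _ _ _ _ H), (opSum_local _ _ _ _ _ Hw), (opSum_local _ _ _ _ _ Hz).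
apply functional_extensionality; intros j.
unfold local_sum, local_L, local_Linv, local_Lminus, cadd, lin_comb; cbn [fst snd]; f_equal; ring.
Qed.

Definition swap (w : cseq) : cseq := fun k => (snd (w k), fst (w k)).

Lemma swap_involutive w : swap (swap w) = w.
Proof. apply functional_extensionality; intros k; unfold swap; now destruct (w k). Qed.

Lemma swap_phase_space p : phase_space p -> phase_space (swap p).
Proof.
intros [H1 H2]; split.
- apply rapid_iff in H1; apply rapid_iff; split; apply H1.
- intros k E; apply (H2 k); rewrite <- E; unfold swap; cbn [fst snd]; ring.
Qed.

(** Exchanging q with r and u with v turns L into its inverse and leaves L_-
    unchanged.  Hence only the half m >= 0 of the hierarchy has to be
    computed. *)
Lemma opSum_swap p w : phase_space p -> telescoping p w ->
  telescoping (swap p) (swap w) /\ opSum (swap p) (swap w) = swap (opSum p w).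
Proof.
intros [_ Hp] (s & k & r & H).
assert (G : potentials (swap p) (swap w) (fun j => - s j) (fun j => - r j) (fun j => - k j)).
{ destruct H as [A1 A2 A3 A4 A5 A6].
  split; try (now apply rapidC_opp); intros j; unfold swap; cbn [fst snd].
  - transitivity (- (s (j + 1)%Z - s j)); [|ring].
    assert (1 - fst (p j) * snd (p j) <> 0) by (intros E; apply (Hp j); rewrite <- E; ring).
    rewrite <- A4; unfold ssum; cbn [fst snd]; field; auto.
  - transitivity (- (r (j + 1)%Z - r j)); [|ring]; rewrite <- A6; ring.
  - transitivity (- (k (j + 1)%Z - k j)); [|ring]; rewrite <- A5; ring. }
split; [now exists (fun j => - s j), (fun j => - r j), (fun j => - k j)|].
rewrite (opSum_local _ _ _ _ _ G), (opSum_local _ _ _ _ _ H).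
apply functional_extensionality; intros j.
unfold local_sum, local_L, local_Linv, local_Lminus, cadd, swap; cbn [fst snd]; f_equal; ring.
Qed.

(** * The hierarchy *)

(** The fields Y_m for m >= 0. *)
Definition one_sided_field (p : cseq) (m : nat) : cseq :=
  match m with O => swap p | S m => res_field p m end.

Section HalfHierarchy.
Variable p : cseq.
Hypothesis Hp : phase_space p.
Let q k := fst (p k).
Let r k := snd (p k).
Let a k m := res_a (res p) k m.
Let B k m := res_B (res p) k m.
Let c k m := res_c (res p) k m.
(* The coefficient of index m - 1 of a, which is 0 for m = 0. *)
Let a1 k m := (fps_X * res_a (res p) k)%S m.

Lemma coef_B_S k m : B (k + 1) (S m) = B k m - q k * (a k m + a (k + 1) m).
Proof.
unfold B at 1; rewrite res_B_eq; unfold fps_add at 1, fps_sub.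
rewrite !fps_X_mul_S, fps_const_mul; unfold fps_add, B, a, q; simpl; ring.
Qed.

Lemma coef_B_0 k : B (k + 1) O = q k.
Proof.
unfold B at 1; rewrite res_B_eq; unfold fps_add at 1, fps_sub.
rewrite !fps_X_mul_O; unfold q; simpl; ring.
Qed.

Lemma coef_c_S k m : c k (S m) = c (k + 1) m - r k * (a k m + a (k + 1) m).
Proof.
unfold c at 1; rewrite res_c_eq; unfold fps_add at 1, fps_sub.
rewrite !fps_X_mul_S, fps_const_mul; unfold fps_add, c, a, r; simpl; ring.
Qed.

Lemma coef_c_0 k : c k O = r k.
Proof.
unfold c at 1; rewrite res_c_eq; unfold fps_add at 1, fps_sub.
rewrite !fps_X_mul_O; unfold r; simpl; ring.
Qed.

Lemma coef_a_0 k : a k O = B k O * c k O.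
Proof.
unfold a at 1; rewrite res_a_eq; unfold fps_add at 1; rewrite fps_X_mul_O.
unfold fps_mul, B, c; simpl; ring.
Qed.

Lemma coef_diff k m : a (k + 1) m - a k m = q k * c (k + 1) m - r k * B k m.
Proof.
pose proof (f_equal (fun f : fps => f m) (res_diff p k)) as H.
unfold fps_sub in H; rewrite !fps_const_mul in H; exact H.
Qed.

Lemma coef_X_diff k m : a1 (k + 1) m - a1 k m = q k * c k m - r k * B (k + 1) m.
Proof.
pose proof (f_equal (fun f : fps => f m) (res_X_diff p k)) as H.
unfold fps_sub in H; rewrite !fps_const_mul in H; exact H.
Qed.

(** A second expression of Y_m, one step lower in the recursion for c and B.
    Comparing it with the definition of Y_{m+1} is the reason why the inverse of
    L raises m and L lowers it; at m = 0 it gives (r, q). *)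
Lemma one_sided_field_alt (m : nat) (k : Z) :
  one_sided_field p m k = (c k m + r k * a1 k m, B (k + 1) m + q k * a1 (k + 1) m).
Proof.
destruct m as [|m].
- unfold a1; rewrite !fps_X_mul_O, coef_c_0, coef_B_0.
  unfold one_sided_field, swap, q, r; f_equal; ring.
- unfold a1; rewrite !fps_X_mul_S, coef_c_S, coef_B_S.
  unfold one_sided_field, res_field; fold (a k m) (a (k + 1) m) (B k m) (c (k + 1) m) (q k) (r k).
  f_equal; ring.
Qed.

Lemma res_rapid : fps_rapid (res_a (res p)) /\ fps_rapid (res_B (res p)) /\ fps_rapid (res_c (res p)).
Proof.
destruct (res_has_jet p p) as [D (Ha & HB & Hc)]; try apply Hp.
repeat split; intros n.
- destruct (Ha n) as [H _]; now rewrite shift_0 in H.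
- destruct (HB n) as [H _]; now rewrite shift_0 in H.
- destruct (Hc n) as [H _]; now rewrite shift_0 in H.
Qed.

Lemma q_rapid : rapidC q.
Proof. destruct Hp as [H _]; now apply rapid_iff in H. Qed.

Lemma r_rapid : rapidC r.
Proof. destruct Hp as [H _]; now apply rapid_iff in H. Qed.

Lemma one_sided_field_rapid m : rapid (one_sided_field p m).
Proof.
pose proof q_rapid; pose proof r_rapid; destruct res_rapid as (Ha & HB & Hc).
apply rapid_iff; destruct m as [|m]; [now split|].
split; cbn [one_sided_field res_field fst snd].
- apply rapidC_minus; [apply (rapidC_translate 1 _ (Hc m))|].
  apply rapidC_mult; [easy|apply (rapidC_translate 1 _ (Ha m))].
- apply rapidC_minus; [apply HB|apply rapidC_mult; [easy|apply Ha]].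
Qed.

(** Neighbouring values of Y_{m+1}, written so that [coef_diff] and
   [coef_X_diff] apply to the summands of the operators. *)
Lemma res_field_next (m : nat) (k : Z) :
  fst (res_field p m (k + 1)%Z) = c (k + 1) (S m) + r (k + 1)%Z * a (k + 1) m.
Proof.
rewrite coef_c_S; unfold res_field; cbn [fst snd].
fold (a (k + 1 + 1) m) (c (k + 1 + 1) m) (r (k + 1)%Z); ring.
Qed.

Lemma res_field_prev (m : nat) (k : Z) :
  snd (res_field p m (k - 1)%Z) = B k (S m) + q (k - 1)%Z * a k m.
Proof.
pose proof (coef_B_S (k - 1) m) as H; replace (k - 1 + 1)%Z with k in H by ring.
rewrite H; unfold res_field; cbn [fst snd].
fold (a (k - 1) m) (B (k - 1) m) (q (k - 1)%Z); ring.
Qed.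

Lemma res_field_fst_prev (m : nat) (k : Z) :
  fst (res_field p m (k - 1)%Z) = c k m - r (k - 1)%Z * a k m.
Proof. unfold res_field; cbn [fst snd]; now replace (k - 1 + 1)%Z with k by ring. Qed.

Lemma res_field_potentials m : potentials p (res_field p m) (fun k => a k m)
  (fun k => a1 k m + q k * (r (k - 1)%Z * a k m))
  (fun k => a k (S m) + q (k - 1)%Z * (r k * a k m)).
Proof.
pose proof q_rapid; pose proof r_rapid; destruct res_rapid as (Ha & HB & Hc).
split.
- apply Ha.
- apply rapidC_plus; [apply (fps_rapid_X_mul _ Ha)|].
  apply rapidC_mult; [easy|apply rapidC_mult; [apply (rapidC_translate (-1) _ r_rapid)|apply Ha]].
- apply rapidC_plus; [apply Ha|].
  apply rapidC_mult; [apply (rapidC_translate (-1) _ q_rapid)|apply rapidC_mult; [easy|apply Ha]].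
- intros j; rewrite coef_diff; unfold ssum, res_field; cbn [fst snd].
  fold (q j) (r j) (a (j + 1) m) (a j m) (B j m) (c (j + 1) m).
  pose proof (coef_diff j m) as E; set (x := c (j + 1) m) in *; set (y := B j m) in *.
  replace (a (j + 1) m) with (a j m + (q j * x - r j * y)) by (rewrite <- E; ring).
  field; apply Hp.
- intros j; rewrite res_field_fst_prev; unfold res_field; cbn [fst snd].
  fold (q j) (r j) (q (j + 1)%Z) (a (j + 1) m) (B (j + 1) m).
  replace (j + 1 - 1)%Z with j by ring.
  transitivity ((a1 (j + 1) m - a1 j m) + q (j + 1)%Z * (r j * a (j + 1) m)
    - q j * (r (j - 1)%Z * a j m)); [rewrite coef_X_diff|]; ring.
- intros j; rewrite res_field_next, res_field_prev; fold (q j) (r j).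
  replace (j + 1 - 1)%Z with j by ring.
  transitivity ((a (j + 1) (S m) - a j (S m)) + q j * (r (j + 1)%Z * a (j + 1) m)
    - q (j - 1)%Z * (r j * a j m)); [rewrite coef_diff|]; ring.
Qed.

Lemma one_sided_field_step m : telescoping p (one_sided_field p (S m)) /\
  opSum p (one_sided_field p (S m)) = lin_comb 2 2 (one_sided_field p (S (S m))) (one_sided_field p m).
Proof.
pose proof (res_field_potentials m) as H.
split; [now eexists _, _, _; exact H|].
change (one_sided_field p (S m)) with (res_field p m); rewrite (opSum_local _ _ _ _ _ H).
apply functional_extensionality; intros k.
unfold lin_comb; rewrite (one_sided_field_alt m).
unfold local_sum, local_L, local_Linv, local_Lminus, cadd; cbn [fst snd].
rewrite res_field_next, res_field_prev, res_field_fst_prev.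
change (one_sided_field p (S (S m))) with (res_field p (S m)).
unfold res_field; cbn [fst snd]; replace (k + 1 - 1)%Z with k by ring.
fold (q k) (r k) (q (k + 1)%Z) (r (k + 1)%Z) (q (k - 1)%Z) (r (k - 1)%Z)
  (a (k + 1) m) (a k (S m)) (a (k + 1) (S m)) (B k (S m)) (B (k + 1) m) (c (k + 1) (S m)).
pose proof (coef_X_diff k m) as E; pose proof (coef_diff k (S m)) as E'.
f_equal.
- replace (a1 (k + 1) m) with (a1 k m + (q k * c k m - r k * B (k + 1) m)) by (rewrite <- E; ring).
  ring.
- replace (a (k + 1) (S m)) with (a k (S m) + (q k * c (k + 1) (S m) - r k * B k (S m)))
    by (rewrite <- E'; ring).
  ring.
Qed.
End HalfHierarchy.

(** At m = 0 the summand s vanishes identically and Y_{-1}, Y_1 are the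
    nearest neighbour fields, so that everything is explicit. *)
Lemma one_sided_field_start p : phase_space p -> telescoping p (one_sided_field p 0) /\
  opSum p (one_sided_field p 0) = lin_comb 2 2 (one_sided_field p 1) (swap (one_sided_field (swap p) 1)).
Proof.
intros Hp; pose proof (q_rapid p Hp) as Hq; pose proof (r_rapid p Hp) as Hr.
assert (H : potentials p (one_sided_field p 0) (fun _ => 0)
  (fun k => - (fst (p k) * snd (p (k - 1)%Z))) (fun k => fst (p (k - 1)%Z) * snd (p k))).
{ split.
  - apply rapidC_0.
  - apply rapidC_opp, rapidC_mult; [easy|apply (rapidC_translate (-1) _ Hr)].
  - apply rapidC_mult; [apply (rapidC_translate (-1) _ Hq)|easy].
  - intros j; unfold ssum, one_sided_field, swap; cbn [fst snd]; field; apply Hp.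
  - intros j; unfold one_sided_field, swap; cbn [fst snd]; replace (j + 1 - 1)%Z with j by ring; ring.
  - intros j; unfold one_sided_field, swap; cbn [fst snd]; replace (j + 1 - 1)%Z with j by ring; ring. }
split; [now eexists _, _, _; exact H|].
rewrite (opSum_local _ _ _ _ _ H).
assert (E : forall p k, one_sided_field p 1 k =
  ((1 - fst (p k) * snd (p k)) * snd (p (k + 1)%Z), (1 - fst (p k) * snd (p k)) * fst (p (k - 1)%Z))).
{ clear; intros p k; unfold one_sided_field, res_field.
  pose proof (coef_B_0 p (k - 1)) as E1; replace (k - 1 + 1)%Z with k in E1 by ring.
  rewrite !coef_a_0, E1, !coef_c_0, coef_B_0; f_equal; ring. }
apply functional_extensionality; intros k; unfold lin_comb.
change (swap (one_sided_field (swap p) 1) k)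
  with (snd (one_sided_field (swap p) 1 k), fst (one_sided_field (swap p) 1 k)); rewrite !E.
unfold local_sum, local_L, local_Linv, local_Lminus, cadd, one_sided_field, swap; cbn [fst snd].
replace (k + 1 - 1)%Z with k by ring; f_equal; ring.
Qed.

(** The two-sided family Y_m. *)
Definition hierarchy_field (p : cseq) (m : Z) : cseq :=
  match m with
  | Z0 => one_sided_field p 0
  | Zpos n => one_sided_field p (Pos.to_nat n)
  | Zneg n => swap (one_sided_field (swap p) (Pos.to_nat n))
  end.

Lemma hierarchy_field_nonneg p n : hierarchy_field p (Z.of_nat n) = one_sided_field p n.
Proof. destruct n as [|n]; [reflexivity|]; simpl; now rewrite SuccNat2Pos.id_succ. Qed.

Lemma hierarchy_field_nonpos p n : hierarchy_field p (- Z.of_nat n) = swap (one_sided_field (swap p) n).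
Proof.
destruct n as [|n]; [simpl; now rewrite !swap_involutive|].
simpl; now rewrite SuccNat2Pos.id_succ.
Qed.

Lemma hierarchy_field_rapid p m : phase_space p -> rapid (hierarchy_field p m).
Proof.
intros Hp; destruct m; try now apply one_sided_field_rapid.
pose proof (one_sided_field_rapid (swap p) (swap_phase_space p Hp) (Pos.to_nat p0)) as H.
apply rapid_iff in H; apply rapid_iff; split; apply H.
Qed.

Lemma lin_comb_comm w z : lin_comb 2 2 w z = lin_comb 2 2 z w.
Proof. apply functional_extensionality; intros k; unfold lin_comb; f_equal; ring. Qed.

Lemma swap_lin_comb x y w z : swap (lin_comb x y w z) = lin_comb x y (swap w) (swap z).
Proof. reflexivity. Qed.

Lemma hierarchy_field_step p m : phase_space p -> telescoping p (hierarchy_field p m) /\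
  opSum p (hierarchy_field p m) = lin_comb 2 2 (hierarchy_field p (m + 1)) (hierarchy_field p (m - 1)).
Proof.
intros Hp; destruct (Z.lt_trichotomy m 0) as [Hm | [-> | Hm]].
- set (n := Z.to_nat (- m - 1)).
  replace m with (- Z.of_nat (S n))%Z by lia.
  replace (- Z.of_nat (S n) + 1)%Z with (- Z.of_nat n)%Z by lia.
  replace (- Z.of_nat (S n) - 1)%Z with (- Z.of_nat (S (S n)))%Z by lia.
  rewrite !hierarchy_field_nonpos.
  pose proof (swap_phase_space p Hp) as Hs.
  destruct (one_sided_field_step (swap p) Hs n) as [A E].
  destruct (opSum_swap (swap p) _ Hs A) as [A' E'].
  rewrite swap_involutive in A', E'; split; [easy|].
  rewrite E', E, swap_lin_comb; apply lin_comb_comm.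
- apply (one_sided_field_start p Hp).
- set (n := Z.to_nat (m - 1)).
  replace m with (Z.of_nat (S n))%Z by lia.
  replace (Z.of_nat (S n) + 1)%Z with (Z.of_nat (S (S n)))%Z by lia.
  replace (Z.of_nat (S n) - 1)%Z with (Z.of_nat n)%Z by lia.
  rewrite !hierarchy_field_nonneg; apply (one_sided_field_step p Hp n).
Qed.

(** * The complex logarithm *)

(** By the mean value theorem, since the derivative of atan x - x is
    - x^2 / (1 + x^2). *)
Lemma atan_second_order (z : R) : (Rabs (atan z - z) <= z ^ 2)%R.
Proof.
destruct (MVT_gen (fun x => atan x - x)%R 0 z (fun x => / (1 + x²) - 1)%R) as (x & Hx & E).
- intros x _; auto_derive; [easy|]; unfold Rsqr; field; nra.
- intros x _; apply continuity_pt_minus; [|apply continuity_pt_id].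
  apply derivable_continuous_pt, derivable_pt_atan.
- rewrite atan_0 in E; replace (atan z - z)%R with ((/ (1 + x²) - 1) * z)%R
    by (rewrite Rminus_0_r in E; lra).
  rewrite Rabs_mult.
  assert (Hz : (Rabs x <= Rabs z)%R).
  { unfold Rabs; destruct (Rcase_abs x), (Rcase_abs z); revert Hx; unfold Rmin, Rmax;
      destruct (Rle_dec 0 z); lra. }
  assert (Hd : (Rabs (/ (1 + x²) - 1) <= Rabs x)%R).
  { unfold Rsqr; assert (0 < 1 + x * x)%R by nra.
    replace (/ (1 + x * x) - 1)%R with (- (x * x / (1 + x * x)))%R by (field; lra).
    rewrite Rabs_Ropp, Rabs_pos_eq
      by (apply Rmult_le_pos; [nra|left; now apply Rinv_0_lt_compat]).
    apply (Rmult_le_reg_r (1 + x * x)); [easy|].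
    replace (x * x / (1 + x * x) * (1 + x * x))%R with (x * x)%R by (field; lra).
    unfold Rabs; destruct (Rcase_abs x); nra. }
  replace (z ^ 2)%R with (Rabs z * Rabs z)%R
    by (rewrite <- Rabs_mult, Rabs_pos_eq by nra; ring).
  apply Rmult_le_compat_r; [apply Rabs_pos|lra].
Qed.

(** The real part is half the logarithm of |1 + w|^2, enclosed by
    1 - 1/z <= ln z <= z - 1; the imaginary part is twice an arc tangent by the
    half-angle formula. *)
Lemma Clog_second_order (w : C) :
  (Cmod w <= 1 / 8)%R -> (Cmod (Clog (1 + w) - w) <= 8 * Cmod w ^ 2)%R.
Proof.
intros Hw.
pose proof (re_le_Cmod w) as Hx; pose proof (im_le_Cmod w) as Hy.
pose proof (Cmod2_alt w) as Hm; pose proof (Cmod2_alt (1 + w)) as Hc.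
pose proof (Cmod_ge_0 w) as Hm0; pose proof (Cmod_ge_0 (1 + w)) as Hc0.
unfold Re, Im in *.
assert (Hc1 : (Rabs (Cmod (1 + w) - 1) <= Cmod w)%R).
{ apply Rabs_le; split.
  - pose proof (Cmod_triangle (1 + w) (- w)) as H; rewrite Cmod_opp in H.
    replace (1 + w + - w) with (RtoC 1) in H by ring; rewrite Cmod_1 in H; lra.
  - pose proof (Cmod_triangle 1 w) as H; rewrite Cmod_1 in H; lra. }
eapply Rle_trans; [apply Cmod_le_re_im|].
unfold Clog, Carg.
destruct w as [x y]; simpl fst in *; simpl snd in *.
replace (0 + y)%R with y in * by ring.
set (m := Cmod (x, y)) in *; set (c := Cmod (1 + (x, y))) in *; clearbody m c.
apply Rabs_le_between in Hc1; apply Rabs_le_between in Hx; pose proof Hy as Hy'.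
apply Rabs_le_between in Hy'.
assert (HD : (7 / 4 <= c + (1 + x))%R) by lra.
destruct (Req_dec_T (c + (1 + x)) 0) as [H0|H0]; [lra|].
assert (A : (Rabs (ln c + - x) <= 3 * m ^ 2)%R).
{ assert (Hcp : (0 < c)%R) by lra.
  assert (Hl : (2 * ln c = ln (c ^ 2))%R).
  { replace (c ^ 2)%R with (c * c)%R by ring; rewrite ln_mult by easy; ring. }
  assert (Hu : (c ^ 2 = 1 + (2 * x + m ^ 2))%R) by (rewrite Hc, Hm; ring).
  assert (Hln : forall z, (0 < z)%R -> (ln z <= z - 1)%R).
  { intros z Hz; pose proof (exp_ineq1_le (ln z)) as H; rewrite exp_ln in H by easy; lra. }
  assert (Hc2 : (0 < c ^ 2)%R) by (apply pow_lt; lra).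
  pose proof (Hln _ Hc2) as H1.
  pose proof (Hln _ (Rinv_0_lt_compat _ Hc2)) as H2; rewrite ln_Rinv in H2 by easy.
  assert (H3 : (1 - / c ^ 2 >= (2 * x + m ^ 2) - 6 * m ^ 2)%R).
  { set (u := (2 * x + m ^ 2)%R) in *.
    assert (Hu2 : (u ^ 2 <= 289 / 64 * m ^ 2)%R).
    { assert (Rabs u <= 17 / 8 * m)%R by (apply Rabs_le; unfold u; split; nra).
      rewrite <- (pow2_abs u); replace (289 / 64 * m ^ 2)%R with ((17 / 8 * m) ^ 2)%R by field.
      apply pow_incr; split; [apply Rabs_pos|easy]. }
    assert (Hc78 : (49 / 64 <= c ^ 2)%R) by nra.
    apply Rle_ge, (Rmult_le_reg_r (c ^ 2)); [easy|].
    replace ((1 - / c ^ 2) * c ^ 2)%R with (c ^ 2 - 1)%R by (field; lra).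
    assert (6 * (49 / 64) * m ^ 2 <= 6 * m ^ 2 * c ^ 2)%R by nra.
    rewrite Hu in *; nra. }
  apply Rabs_le; split; nra. }
assert (B : (Rabs (2 * atan (y / (c + (1 + x))) + - y) <= 2 * m ^ 2)%R).
{ set (D := (c + (1 + x))%R) in *; set (z := (y / D)%R).
  assert (Hz : (y = z * D)%R) by (unfold z; field; lra).
  assert (Hzm : (Rabs z <= 4 / 7 * m)%R).
  { unfold z, Rdiv; rewrite Rabs_mult, Rabs_inv, (Rabs_pos_eq D) by lra.
    apply (Rmult_le_reg_r D); [lra|].
    replace (Rabs y * / D * D)%R with (Rabs y) by (field; lra); nra. }
  pose proof (atan_second_order z) as H1.
  assert (H2 : (z ^ 2 <= 16 / 49 * m ^ 2)%R).
  { rewrite <- (pow2_abs z); replace (16 / 49 * m ^ 2)%R with ((4 / 7 * m) ^ 2)%R by field.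
    apply pow_incr; split; [apply Rabs_pos|easy]. }
  assert (H3 : (Rabs (z * (2 - D)) <= 8 / 7 * m ^ 2)%R).
  { rewrite Rabs_mult; assert (Rabs (2 - D) <= 2 * m)%R by (apply Rabs_le; unfold D; lra).
    replace (8 / 7 * m ^ 2)%R with (4 / 7 * m * (2 * m))%R by field.
    apply Rmult_le_compat; try apply Rabs_pos; easy. }
  replace (2 * atan z + - y)%R with (2 * (atan z - z) + z * (2 - D))%R by (rewrite Hz at 1; ring).
  apply Rabs_le_between in H1; apply Rabs_le_between in H3; apply Rabs_le; split; nra. }
nra.
Qed.

Lemma Clog_1 : Clog 1 = 0.
Proof.
assert (H : (Cmod (Clog (1 + 0) - 0) <= 8 * Cmod 0 ^ 2)%R)
  by (apply Clog_second_order; rewrite Cmod_0; lra).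
rewrite Cmod_0 in H; replace (1 + 0) with (RtoC 1) in H by ring.
replace (Clog 1) with (Clog 1 - 0) by ring.
apply Cmod_eq_0; pose proof (Cmod_ge_0 (Clog 1 - 0)); lra.
Qed.

Definition congr_2pi (z w : C) : Prop :=
  fst z = fst w /\ exists n : Z, snd z = (snd w + 2 * PI * IZR n)%R.

Lemma Clog_mult (z w : C) : z <> 0 -> w <> 0 -> congr_2pi (Clog (z * w)) (Clog z + Clog w).
Proof.
intros Hz Hw.
assert (Hzw : z * w <> 0) by now apply Cmult_neq_0.
split.
- simpl; rewrite Cmod_mult; apply ln_mult; now apply Cmod_gt_0.
- destruct (Clog_correct z Hz) as [Ez _], (Clog_correct w Hw) as [Ew _],
    (Clog_correct (z * w) Hzw) as [E _].
  assert (Hf : (exp (fst (Clog (z * w))) = exp (fst (Clog z)) * exp (fst (Clog w)))%R).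
  { simpl; rewrite Cmod_mult, ln_mult by (now apply Cmod_gt_0); apply exp_plus. }
  assert (H : z * w = (exp (fst (Clog (z * w))) * cos (snd (Clog z) + snd (Clog w)),
                       exp (fst (Clog (z * w))) * sin (snd (Clog z) + snd (Clog w)))%R).
  { rewrite Hf, cos_plus, sin_plus; rewrite Ez at 1; rewrite Ew at 1.
    unfold Cmult; simpl fst; simpl snd; f_equal; ring. }
  rewrite H in E at 1.
  set (b := snd (Clog (z * w))) in *.
  simpl snd; set (b' := (snd (Clog z) + snd (Clog w))%R) in *.
  injection E; intros E2 E1.
  apply Rmult_eq_reg_l in E1; [|apply Rgt_not_eq, exp_pos].
  apply Rmult_eq_reg_l in E2; [|apply Rgt_not_eq, exp_pos].
  assert (Hcos : cos (2 * ((b - b') / 2)) = 1%R).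
  { replace (2 * ((b - b') / 2))%R with (b - b')%R by field.
    rewrite cos_minus, <- E1, <- E2; rewrite Rplus_comm; apply sin2_cos2. }
  rewrite cos_2a_sin in Hcos.
  destruct (sin_eq_0_0 ((b - b') / 2)) as [n Hn]; [nra|].
  exists n; change (b = b' + 2 * PI * IZR n)%R; clearbody b b'; lra.
Qed.

(** * Congruences and branches *)

(** [branch] picks the determination of [F p'] nearest to [F p]. *)
Lemma branch_congr (F : functional) p p' g :
  congr_2pi (F p') g -> (Rabs (snd g - snd (F p)) < PI)%R -> branch F p p' = g.
Proof.
intros [E1 [n E2]] Hg; unfold branch; pose proof PI_RGT_0 as HPI.
set (x := ((snd (F p') - snd (F p)) / (2 * PI) + / 2)%R).
apply Rabs_lt_between in Hg.
assert (Hx : (IZR n < x < IZR n + 1)%R).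
{ assert (x - IZR n = (snd g - snd (F p) + PI) / (2 * PI))%R
    by (unfold x; rewrite E2; field; lra).
  assert (0 < (snd g - snd (F p) + PI) / (2 * PI) < 1)%R; [|lra].
  split; [apply Rdiv_lt_0_compat; lra|].
  apply (Rmult_lt_reg_r (2 * PI)); [lra|].
  replace ((snd g - snd (F p) + PI) / (2 * PI) * (2 * PI))%R with (snd g - snd (F p) + PI)%R
    by (field; lra); lra. }
assert (Int_part x = n) as ->.
{ destruct (base_Int_part x) as [I1 I2].
  assert (IZR (Int_part x) < IZR (n + 1))%R as I3 by (rewrite plus_IZR; lra).
  assert (IZR n < IZR (Int_part x + 1))%R as I4 by (rewrite plus_IZR; lra).
  apply lt_IZR in I3; apply lt_IZR in I4; lia. }
rewrite E1, E2; destruct g as [g1 g2]; simpl; f_equal; ring.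
Qed.

(** [F] has along the line through [p] in the direction [v] a determination
    modulo 2 i PI that is differentiable at [p].  Unlike [branch], this notion
    is stable under addition: jumps of the summands need not be tracked. *)
Definition has_lift (F : functional) (p v : cseq) (d : C) : Prop :=
  exists G : C -> C, G 0 = F p /\ @is_derive C_AbsRing C_NormedModule G (RtoC 0) d /\
    @locally (AbsRing_UniformSpace C_AbsRing) (RtoC 0)
      (fun t => congr_2pi (F (shift p t v)) (G t)).

(** Both the lift and the branch are congruent to [F], and by continuity of the
    lift they differ by less than 2 PI near [p]. *)
Lemma has_lift_branch F p v d : has_lift F p v d ->
  @is_derive C_AbsRing C_NormedModule (fun t => branch F p (shift p t v)) (RtoC 0) d.
Proof.
intros (G & E & HG & Hloc).
apply (is_derive_ext_loc G); [|exact HG].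
assert (Hc : @locally (AbsRing_UniformSpace C_AbsRing) (RtoC 0)
  (fun t => (Cmod (G t - G 0) < PI)%R)).
{ pose proof (@ex_derive_continuous C_AbsRing C_NormedModule G (RtoC 0) (ex_intro _ d HG)) as Hcont.
  exact (proj1 (@filterlim_locally_ball_norm C_AbsRing C C_NormedModule _ _ G (G 0)) Hcont
    (mkposreal PI PI_RGT_0)). }
generalize (filter_and _ _ Hloc Hc); apply filter_imp; intros t [H1 H2].
symmetry; apply branch_congr; [exact H1|].
rewrite <- E; eapply Rle_lt_trans; [|exact H2].
apply (im_le_Cmod (G t - G 0)).
Qed.

(** The factor 2 is an integer, so congruences modulo 2 i PI are preserved. *)
Lemma has_lift_twice_sum F F' p v d d' : has_lift F p v d -> has_lift F' p v d' ->
  has_lift (fun p => 2 * (F p + F' p)) p v (2 * (d + d')).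
Proof.
intros (G & E & HG & Hloc) (G' & E' & HG' & Hloc').
exists (fun t => (G t + G' t) + (G t + G' t)); split; [rewrite E, E'; ring|]; split.
- replace (2 * (d + d')) with ((d + d') + (d + d')) by ring.
  pose proof (is_derive_plus _ _ _ _ _ HG HG') as H.
  exact (is_derive_plus _ _ _ _ _ H H).
- generalize (filter_and _ _ Hloc Hloc'); apply filter_imp; intros t [[H1 [n H2]] [H3 [n' H4]]].
  split; [simpl|exists (2 * (n + n'))%Z; rewrite mult_IZR, plus_IZR; simpl]; rewrite H1, H2, H3, H4; ring.
Qed.

Lemma congr_2pi_refl (z : C) : congr_2pi z z.
Proof. split; [easy|]; exists 0%Z; ring. Qed.

Lemma has_lift_derive F p v d :
  @is_derive C_AbsRing C_NormedModule (fun t => F (shift p t v)) (RtoC 0) d -> has_lift F p v d.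
Proof.
intros H; exists (fun t => F (shift p t v)); split; [now rewrite shift_0|]; split; [easy|].
apply filter_forall; intros t; apply congr_2pi_refl.
Qed.

(** The partial sums are integers and converge, so they are eventually
    constant. *)
Lemma is_series_integers (a : nat -> R) (l : R) :
  (forall n, exists m : Z, a n = IZR m) -> is_series a l -> exists m : Z, l = IZR m.
Proof.
intros Ha Hl.
assert (HS : forall n, exists m : Z, sum_n a n = IZR m).
{ induction n as [|n [m Hm]].
  - rewrite sum_O; apply Ha.
  - rewrite sum_Sn, Hm; destruct (Ha (S n)) as [m' ->]; exists (m + m')%Z.
    now rewrite plus_IZR. }
assert (Hlim : is_lim_seq (sum_n a) l) by exact Hl.
apply is_lim_seq_spec in Hlim.
destruct (Hlim (mkposreal (1 / 4) ltac:(lra))) as [N HN]; simpl in HN.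
destruct (HS N) as [m Hm]; exists m.
destruct (Req_dec l (IZR m)) as [|Hne]; [easy|exfalso].
assert (Hpos : (0 < Rabs (IZR m - l))%R) by (apply Rabs_pos_lt; lra).
destruct (Hlim (mkposreal _ Hpos)) as [N' HN']; simpl in HN'.
pose proof (HN N (Nat.le_refl _)) as B0.
pose proof (HN (max N N') (Nat.le_max_l _ _)) as B1.
pose proof (HN' (max N N') (Nat.le_max_r _ _)) as B2.
destruct (HS (max N N')) as [m' Hm']; rewrite Hm in B0; rewrite Hm' in B1, B2.
assert (m' = m) as ->.
{ apply Rabs_lt_between in B0; apply Rabs_lt_between in B1.
  assert (IZR m' < IZR (m + 1))%R as I1 by (rewrite plus_IZR; lra).
  assert (IZR m < IZR (m' + 1))%R as I2 by (rewrite plus_IZR; lra).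
  apply lt_IZR in I1; apply lt_IZR in I2; lia. }
lra.
Qed.

Lemma sum_Z_congr_2pi f g : decay2 f -> decay2 g ->
  (forall k, congr_2pi (f k) (g k)) -> congr_2pi (sum_Z f) (sum_Z g).
Proof.
intros Hf Hg H.
set (h := fun k => 1 * f k + (-1) * g k).
assert (Hh : forall k, fst (h k) = 0%R /\ exists n : Z, snd (h k) = (2 * PI * IZR n)%R).
{ intros k; destruct (H k) as [H1 [n Hn]]; split.
  - unfold h; simpl; rewrite H1; ring.
  - exists n; unfold h; simpl; rewrite Hn; ring. }
assert (Hcsum : forall a l, is_csum a l ->
  (forall n : nat, fst (a n) = 0%R /\ exists m : Z, snd (a n) = (2 * PI * IZR m)%R) ->
  fst l = 0%R /\ exists m : Z, snd l = (2 * PI * IZR m)%R).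
{ clear; intros a l [H1 H2] Ha; pose proof PI_RGT_0; split.
  - rewrite <- (is_series_unique _ _ H1).
    transitivity (Series (fun n => 0 * fst (a n))%R).
    + apply Series_ext; intros n; rewrite (proj1 (Ha n)); real_ring.
    + rewrite Series_scal_l; real_ring.
  - destruct (is_series_integers (fun n => (/ (2 * PI) * snd (a n))%R) (/ (2 * PI) * snd l)) as [m Hm].
    + intros n; destruct (proj2 (Ha n)) as [m Hm]; exists m; rewrite Hm; field; lra.
    + exact (is_series_scal (/ (2 * PI))%R _ _ H2).
    + exists m; rewrite <- Hm; field; lra. }
destruct (sum_Z_correct h) as (l1 & l2 & S1 & S2 & E); [now apply decay2_lin|].
destruct (Hcsum _ _ S1) as [A1 [n1 A2]]; [intros n; apply Hh|].
destruct (Hcsum _ _ S2) as [B1 [n2 B2]]; [intros n; apply Hh|].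
unfold h in E; rewrite sum_Z_lin in E by easy.
replace (sum_Z f) with (sum_Z g + (l1 + l2)) by (rewrite <- E; ring).
split; simpl.
- rewrite A1, B1; ring.
- exists (n1 + n2)%Z; rewrite A2, B2, plus_IZR; ring.
Qed.

(** * The functional H_0 *)

Lemma bounded_eventually (f : Z -> C) (N : nat) (M : R) :
  (forall k, (Z.of_nat N <= Z.abs k)%Z -> (Cmod (f k) <= M)%R) ->
  exists M', forall k, (Cmod (f k) <= M')%R.
Proof.
revert M; induction N as [|N IH]; intros M H.
- exists M; intros k; apply H; lia.
- apply (IH (M + Cmod (f (Z.of_nat N)) + Cmod (f (- Z.of_nat N)%Z) + Rabs M)%R).
  intros k Hk.
  pose proof (Cmod_ge_0 (f (Z.of_nat N))); pose proof (Cmod_ge_0 (f (- Z.of_nat N)%Z)).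
  pose proof (Rle_abs (- M)) as HM; rewrite Rabs_Ropp in HM; pose proof (Rabs_pos M).
  destruct (Z.eq_dec (Z.abs k) (Z.of_nat N)) as [E|E].
  + destruct (Z.abs_eq_or_opp k) as [E'|E'].
    * replace k with (Z.of_nat N) by lia; lra.
    * replace k with (- Z.of_nat N)%Z by lia; lra.
  + pose proof (H k ltac:(lia)); lra.
Qed.

Lemma rapidC_small f (eps : R) : rapidC f -> (0 < eps)%R ->
  exists N : nat, forall k, (Z.of_nat N <= Z.abs k)%Z -> (Cmod (f k) <= eps)%R.
Proof.
intros Hf He; destruct (rapidC_spec f Hf 1%nat) as [M HM].
exists (Z.to_nat (up (M / eps))); intros k Hk.
assert (HMk : (M / eps <= 1 + IZR (Z.abs k))%R).
{ destruct (archimed (M / eps)) as [Hup _].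
  assert (up (M / eps) <= Z.abs k)%Z as Hk' by lia.
  apply IZR_le in Hk'; lra. }
specialize (HM k); rewrite pow_1 in HM; pose proof (one_le_weight k).
apply (Rmult_le_reg_l (1 + IZR (Z.abs k))); [lra|].
eapply Rle_trans; [exact HM|].
apply Rle_trans with (M / eps * eps)%R; [right; field; lra|].
apply Rmult_le_compat_r; lra.
Qed.

(** For small f the logarithm is comparable to f; the remaining sites are finite
    in number and only affect the constant. *)
Lemma Clog_decay2 f : rapidC f -> decay2 (fun k => Clog (1 + f k)).
Proof.
intros Hf; destruct (rapidC_small f (1 / 8) Hf) as [N HN]; [lra|].
destruct (rapidC_decay2 f Hf) as [M HM].
destruct (bounded_eventually
  (fun k => RtoC ((1 + IZR (Z.abs k)) ^ 2) * Clog (1 + f k)) N (2 * M)) as [M' HM'].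
- intros k Hk; specialize (HN k Hk); specialize (HM k).
  pose proof (weight_pow_pos 2 k) as Hw.
  rewrite Cmod_mult, Cmod_R, Rabs_pos_eq by lra.
  set (wt := ((1 + IZR (Z.abs k)) ^ 2)%R) in *.
  pose proof (Clog_second_order _ HN) as HL.
  assert (Ht : (Cmod (Clog (1 + f k)) <= Cmod (Clog (1 + f k) - f k) + Cmod (f k))%R).
  { eapply Rle_trans; [|apply Cmod_triangle]; right; f_equal; ring. }
  pose proof (Cmod_ge_0 (f k)).
  assert (Cmod (Clog (1 + f k)) <= 2 * Cmod (f k))%R by nra.
  nra.
- exists M'; intros k; specialize (HM' k); pose proof (weight_pow_pos 2 k).
  rewrite Cmod_mult, Cmod_R, Rabs_pos_eq in HM' by lra; exact HM'.
Qed.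

Lemma uniformly_rapid_fixed e t : uniformly_rapid e -> (Cmod t <= 1)%R -> rapidC (e t).
Proof. intros He Ht m; destruct (He m) as [M HM]; exists M; intros k _ _; now apply HM. Qed.

Lemma inv_bounded p : phase_space p ->
  exists K, forall k, (Cmod (/ (1 - fst (p k) * snd (p k))) <= K)%R.
Proof.
intros Hp.
assert (Hqr : rapidC (fun k => fst (p k) * snd (p k))).
{ apply rapidC_mult; [apply (q_rapid p Hp)|apply (r_rapid p Hp)]. }
destruct (rapidC_small _ (1 / 2) Hqr) as [N HN]; [lra|].
apply (bounded_eventually _ N 2); intros k Hk; specialize (HN k Hk).
rewrite Cmod_inv by now apply one_minus_qr_neq_0.
pose proof (Cmod_triangle (1 - fst (p k) * snd (p k)) (fst (p k) * snd (p k))) as H.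
replace (1 - fst (p k) * snd (p k) + fst (p k) * snd (p k)) with (RtoC 1) in H by ring.
rewrite Cmod_1 in H.
replace 2%R with (/ (1 / 2))%R by field; apply Rinv_le_contravar; lra.
Qed.

(** The lift is minus the sum of Clog (1 - q r) at the base point and of Clog of
    the quotient of 1 - q r by its value at the base point.  The quotients are
    close to 1 uniformly in the site, so the logarithm is analytic there even
    where 1 - q r crosses the cut. *)
Lemma H0_has_lift p v : phase_space p -> rapid v -> has_lift H0 p v (pairing p (swap p) v).
Proof.
intros Hp Hv; pose proof (q_rapid p Hp) as Hq; pose proof (r_rapid p Hp) as Hr.
destruct (proj1 (rapid_iff v) Hv) as [Hva Hvb].
set (q := fun k => fst (p k)) in *; set (r := fun k => snd (p k)) in *.
set (a := fun k => fst (v k)) in *; set (b := fun k => snd (v k)) in *.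
destruct (inv_bounded p Hp) as [K HK].
set (inv := fun k => / (1 - fst (p k) * snd (p k))) in *.
assert (Hinv : forall k, (1 - q k * r k) * inv k = 1).
{ intros k; unfold inv, q, r; field; now apply one_minus_qr_neq_0. }
set (y := fun t k => - (inv k * (q k * b k + r k * a k + t * (a k * b k)))).
assert (Hy : uniformly_rapid y).
{ apply (uniformly_rapid_ext (fun t k => (- inv k) * (q k * b k + r k * a k + t * (a k * b k)))).
  - intros t k; unfold y; ring.
  - apply (uniformly_rapid_bmul (fun _ k => - inv k) _ K).
    + intros t k _; rewrite Cmod_opp; apply HK.
    + apply uniformly_rapid_plus; [apply (rapidC_plus _ _ (rapidC_mult _ _ Hq Hvb) (rapidC_mult _ _ Hr Hva))|].
      apply (uniformly_rapid_param (fun _ k => a k * b k)), (rapidC_mult _ _ Hva Hvb). }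
destruct (uniformly_rapid_bounded y Hy) as [Y HY].
set (delta := (/ (8 * (Rabs Y + 1)))%R).
pose proof (Rabs_pos Y) as HY0; pose proof (Rle_abs Y) as HYa.
assert (Hdelta : (0 < delta <= 1)%R).
{ split; [apply Rinv_0_lt_compat; lra|].
  replace 1%R with (/ 1)%R by field; apply Rinv_le_contravar; lra. }
assert (Hsmall : forall t k, (Cmod t <= delta)%R -> (Cmod (t * y t k) <= 1 / 8)%R).
{ intros t k Ht; rewrite Cmod_mult.
  apply Rle_trans with (delta * (Rabs Y + 1))%R; [|right; unfold delta; field; lra].
  specialize (HY t k ltac:(lra)).
  apply Rmult_le_compat; try apply Cmod_ge_0; lra. }
set (f := fun t k => - (Clog (1 + - (q k * r k)) + Clog (1 + t * y t k))).
assert (Hqr : rapidC (fun k => - (q k * r k))) by (apply rapidC_opp, (rapidC_mult _ _ Hq Hr)).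
assert (H0f : forall k, f 0 k = - Clog (1 + - (q k * r k))).
{ intros k; unfold f; replace (1 + 0 * y 0 k) with (RtoC 1) by ring; rewrite Clog_1; ring. }
exists (fun t => sum_Z (f t)); split; [|split].
- rewrite (sum_Z_ext _ _ H0f), sum_Z_opp; reflexivity.
- replace (pairing p (swap p) v) with (sum_Z (fun k => - y 0 k)).
  2: { apply sum_Z_ext; intros k; unfold y, inv, swap; cbn [fst snd]; unfold q, r, a, b.
       field; now apply one_minus_qr_neq_0. }
  destruct (uniformly_rapid_mult _ _ Hy Hy 2%nat) as [M1 HM1].
  assert (Hab : rapidC (fun k => inv k * (a k * b k))).
  { apply (rapidC_bmul _ _ K HK), (rapidC_mult _ _ Hva Hvb). }
  destruct (rapidC_decay2 _ Hab) as [M2 HM2].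
  apply (is_derive_sum_Z f _ delta (8 * M1 + M2)); [easy| | |].
  + destruct (decay2_lin _ _ (-1) 0 (Clog_decay2 _ Hqr) (Clog_decay2 _ Hqr)) as [M HM].
    exists M; intros k; specialize (HM k); rewrite H0f.
    eapply Rle_trans; [|exact HM]; right; do 2 f_equal; ring.
  + apply rapidC_decay2, rapidC_opp, (uniformly_rapid_fixed _ _ Hy); rewrite Cmod_0; lra.
  + intros t k Ht.
    specialize (HM1 k t ltac:(lra)); specialize (HM2 k); pose proof (weight_pow_pos 2 k).
    set (wt := ((1 + IZR (Z.abs k)) ^ 2)%R) in *.
    pose proof (Clog_second_order _ (Hsmall t k Ht)) as HL.
    replace (f t k - f 0 k - t * - y 0 k)
      with (- ((Clog (1 + t * y t k) - t * y t k) - t * t * (inv k * (a k * b k))))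
      by (rewrite H0f; unfold f, y; ring).
    rewrite Cmod_opp.
    apply Rle_trans with (wt * (8 * Cmod (t * y t k) ^ 2 + Cmod (t * t * (inv k * (a k * b k)))))%R.
    * apply Rmult_le_compat_l; [lra|].
      eapply Rle_trans; [apply Cmod_triangle|]; rewrite Cmod_opp; lra.
    * rewrite !Cmod_mult in *; pose proof (pow2_ge_0 (Cmod t)); nra.
- apply (locally_C_ball _ delta (proj1 Hdelta)); intros t Ht.
  assert (Ht1 : (Cmod t <= 1)%R) by lra.
  unfold H0; rewrite <- sum_Z_opp.
  assert (Hwt : rapidC (fun k => t * y t k)).
  { apply rapidC_scal, (uniformly_rapid_fixed _ _ Hy Ht1). }
  apply sum_Z_congr_2pi.
  + assert (Hs : rapidC (fun k => - ((q k + t * a k) * (r k + t * b k)))).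
    { apply rapidC_opp, rapidC_mult; apply rapidC_plus; try apply rapidC_scal; easy. }
    destruct (decay2_lin _ _ (-1) 0 (Clog_decay2 _ Hs) (Clog_decay2 _ Hs)) as [M HM].
    exists M; intros k; specialize (HM k).
    eapply Rle_trans; [|exact HM]; right; do 2 f_equal.
    unfold shift; cbn [fst snd]; fold (q k) (r k) (a k) (b k).
    match goal with |- - Clog ?u = _ * Clog ?w + _ => replace u with w by ring end; ring.
  + destruct (decay2_lin _ _ (-1) (-1) (Clog_decay2 _ Hqr) (Clog_decay2 _ Hwt)) as [M HM].
    exists M; intros k; specialize (HM k).
    eapply Rle_trans; [|exact HM]; right; do 2 f_equal; unfold f; ring.
  + intros k.
    assert (Hne : 1 + t * y t k <> 0).
    { intros E; pose proof (Hsmall t k ltac:(lra)) as Hs.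
      replace (t * y t k) with (- (1)) in Hs.
      - rewrite Cmod_opp, Cmod_1 in Hs; lra.
      - replace (t * y t k) with ((1 + t * y t k) - 1) by ring; rewrite E; ring. }
    assert (Hne' : 1 + - (q k * r k) <> 0) by apply (one_minus_qr_neq_0 p Hp k).
    destruct (Clog_mult _ _ Hne' Hne) as [L1 [n L2]].
    replace (1 - fst (shift p t v k) * snd (shift p t v k))
      with ((1 + - (q k * r k)) * (1 + t * y t k)).
    * split; [simpl; simpl in L1; rewrite L1; reflexivity|].
      exists (- n)%Z; unfold f; rewrite opp_IZR.
      change (snd (- ?u)) with (- snd u)%R; rewrite L2; ring.
    * unfold shift; cbn [fst snd]; fold (q k) (r k) (a k) (b k).
      transitivity (1 - q k * r k - t * (((1 - q k * r k) * inv k)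
        * (q k * b k + r k * a k + t * (a k * b k)))); [unfold y; ring|].
      rewrite Hinv; ring.
Qed.

(** * Gradients *)

(** The order of the components is exchanged because a gradient lists the
    derivative in r first, whereas Y lists the coefficient of delta q first. *)
Definition gradient_of (Y : cseq) : cseq := fun k => (- snd (Y k), - fst (Y k)).

Lemma form_gradient_of p Y v : form p (gradient_of Y) v = pairing p Y v.
Proof.
unfold form, pairing; rewrite <- sum_Z_opp; apply sum_Z_ext; intros k.
unfold gradient_of; cbn [fst snd]; unfold Cdiv; ring.
Qed.

Lemma is_csum_single (a : nat -> C) (n : nat) :
  (forall i, i <> n -> a i = 0) -> is_csum a (a n).
Proof.
assert (G : forall x : nat -> R, (forall i, i <> n -> x i = 0%R) -> is_series x (x n)).
{ clear; intros x Hx.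
  assert (Hs : forall m, sum_n x m = if le_lt_dec n m then x n else 0%R).
  { induction m as [|m IH].
    - rewrite sum_O; destruct (le_lt_dec n 0) as [H|H]; [f_equal|apply Hx]; lia.
    - rewrite sum_Sn, IH; unfold plus; simpl.
      destruct (le_lt_dec n m), (le_lt_dec n (S m)); try lia.
      + rewrite (Hx (S m)) by lia; ring.
      + replace (S m) with n by lia; ring.
      + rewrite (Hx (S m)) by lia; ring. }
  apply (is_lim_seq_ext_loc (fun _ => x n) (sum_n x) (x n)); [|apply is_lim_seq_const].
  exists n; intros m Hm; rewrite Hs; now destruct (le_lt_dec n m); [|lia]. }
intros Ha; split; [apply (G (fun i => fst (a i)))|apply (G (fun i => snd (a i)))];
  intros i Hi; now rewrite Ha.
Qed.

Lemma sum_Z_single (k : Z) (f : Z -> C) :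
  (forall j, j <> k -> f j = 0) -> sum_Z f = f k.
Proof.
intros H; unfold sum_Z, sum_ge, sum_le; destruct (Z_lt_le_dec k 0) as [Hk|Hk].
- rewrite (is_csum_unique _ _ (is_csum_single (fun n => f (0 + Z.of_nat n)%Z) 0
    ltac:(intros; apply H; lia))).
  rewrite (is_csum_unique _ _ (is_csum_single (fun n => f (-1 - Z.of_nat n)%Z) (Z.to_nat (-1 - k))
    ltac:(intros; apply H; lia))).
  rewrite (H (0 + Z.of_nat 0)%Z) by lia; rewrite Cplus_0_l; f_equal; lia.
- rewrite (is_csum_unique _ _ (is_csum_single (fun n => f (0 + Z.of_nat n)%Z) (Z.to_nat k)
    ltac:(intros; apply H; lia))).
  rewrite (is_csum_unique _ _ (is_csum_single (fun n => f (-1 - Z.of_nat n)%Z) 0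
    ltac:(intros; apply H; lia))).
  rewrite (H (-1 - Z.of_nat 0)%Z) by lia; rewrite Cplus_0_r; f_equal; lia.
Qed.

Lemma finite_rapid k : rapidC (delta k).
Proof.
intros m; exists ((1 + IZR (Z.abs k)) ^ m)%R; intros j t _; unfold delta.
destruct (Z.eq_dec j k) as [->|].
- rewrite Cmod_1; lra.
- rewrite Cmod_0; pose proof (weight_pow_pos m k); lra.
Qed.

(** The partial derivatives are the differentials in the directions of the unit
    vectors, where the pairing has a single term. *)
Lemma grad_has_lift (F : functional) (p Y : cseq) : phase_space p ->
  (forall v, rapid v -> has_lift F p v (pairing p Y v)) -> grad F p = gradient_of Y.
Proof.
intros Hp H; apply functional_extensionality; intros k.
assert (Hq : rapid (unit_q k)).
{ apply rapid_iff; split; [apply finite_rapid|apply rapidC_0]. }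
assert (Hr : rapid (unit_r k)).
{ apply rapid_iff; split; [apply rapidC_0|apply finite_rapid]. }
pose proof (one_minus_qr_neq_0 p Hp k) as Hk.
unfold grad, gradient_of; f_equal.
- assert (E : delta_r F p k = pairing p Y (unit_r k))
    by exact (is_C_derive_unique _ _ _ (has_lift_branch _ _ _ _ (H _ Hr))).
  rewrite E.
  unfold pairing; rewrite (sum_Z_single k).
  + unfold unit_r, delta; cbn [fst snd]; destruct (Z.eq_dec k k); [field; easy|easy].
  + intros j Hj; unfold unit_r, delta; cbn [fst snd]; destruct (Z.eq_dec j k); [easy|].
    unfold Cdiv; ring.
- assert (E : delta_q F p k = pairing p Y (unit_q k))
    by exact (is_C_derive_unique _ _ _ (has_lift_branch _ _ _ _ (H _ Hq))).
  rewrite E.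
  unfold pairing; rewrite (sum_Z_single k).
  + unfold unit_q, delta; cbn [fst snd]; destruct (Z.eq_dec k k); [field; easy|easy].
  + intros j Hj; unfold unit_q, delta; cbn [fst snd]; destruct (Z.eq_dec j k); [easy|].
    unfold Cdiv; ring.
Qed.

Lemma pairing_twice_sum p Y Z v : phase_space p -> rapid Y -> rapid Z -> rapid v ->
  pairing p (lin_comb 2 2 Y Z) v = 2 * (pairing p Y v + pairing p Z v).
Proof.
intros Hp HY HZ Hv; destruct (inv_bounded p Hp) as [K HK].
assert (G : forall W, rapid W -> decay2 (fun k =>
  (fst (W k) * fst (v k) + snd (W k) * snd (v k)) / (1 - fst (p k) * snd (p k)))).
{ intros W HW; apply rapid_iff in HW, Hv; destruct HW as [W1 W2], Hv as [V1 V2].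
  apply rapidC_decay2.
  apply (rapidC_ext (fun k => / (1 - fst (p k) * snd (p k)) *
    (fst (W k) * fst (v k) + snd (W k) * snd (v k)))); [intros k; unfold Cdiv; ring|].
  apply (rapidC_bmul _ _ K HK), rapidC_plus; now apply rapidC_mult. }
unfold pairing.
transitivity (2 * sum_Z (fun k => (fst (Y k) * fst (v k) + snd (Y k) * snd (v k)) / (1 - fst (p k) * snd (p k)))
  + 2 * sum_Z (fun k => (fst (Z k) * fst (v k) + snd (Z k) * snd (v k)) / (1 - fst (p k) * snd (p k)))); [|ring].
rewrite <- sum_Z_lin by (now apply G).
apply sum_Z_ext; intros k; unfold lin_comb; cbn [fst snd]; unfold Cdiv; ring.
Qed.

(** * The Lenard chain *)

(** The functional with gradient Y_m; the exchange of q and r gives those with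
    m < 0. *)
Definition conserved (m : Z) : functional :=
  match m with
  | Z0 => H0
  | Zpos n => hamiltonian (pred (Pos.to_nat n))
  | Zneg n => fun p => hamiltonian (pred (Pos.to_nat n)) (swap p)
  end.

Lemma conserved_has_lift m p v : phase_space p -> rapid v ->
  has_lift (conserved m) p v (pairing p (hierarchy_field p m) v).
Proof.
intros Hp Hv; destruct m as [|n|n]; [now apply H0_has_lift| |]; apply has_lift_derive; simpl;
  destruct (Pos.to_nat n) as [|m] eqn:E; try (pose proof (Pos2Nat.is_pos n); lia); simpl.
- now apply hamiltonian_derive.
- replace (pairing p (swap (res_field (swap p) m)) v) with (pairing (swap p) (res_field (swap p) m) (swap v)).
  + apply (hamiltonian_derive (swap p) (swap v)); [now apply swap_phase_space|].
    apply rapid_iff in Hv; apply rapid_iff; split; apply Hv.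
  + apply sum_Z_ext; intros k.
    change (swap (res_field (swap p) m) k) with (snd (res_field (swap p) m k), fst (res_field (swap p) m k)).
    unfold swap at 2 4 5 6; cbn [fst snd]; unfold Cdiv.
    rewrite (Cmult_comm (snd (p k)) (fst (p k))); ring.
Qed.

(** The operator 2 (S + 1/S), S being the shift of m, applied [n] times to the
    family Y; [chain] is the same combination of functionals. *)
Fixpoint chain_field (p : cseq) (n : nat) (m : Z) : cseq :=
  match n with
  | O => hierarchy_field p m
  | S n => lin_comb 2 2 (chain_field p n (m + 1)) (chain_field p n (m - 1))
  end.

Fixpoint chain (n : nat) (m : Z) : functional :=
  match n with
  | O => conserved m
  | S n => fun p => 2 * (chain n (m + 1) p + chain n (m - 1) p)
  end.

Section Chain.
Variable p : cseq.
Hypothesis Hp : phase_space p.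

Lemma chain_field_rapid n m : rapid (chain_field p n m).
Proof.
revert m; induction n as [|n IH]; intros m; [now apply hierarchy_field_rapid|].
pose proof (IH (m + 1)%Z) as A; pose proof (IH (m - 1)%Z) as B.
apply rapid_iff in A, B; apply rapid_iff; split; apply rapidC_plus; apply rapidC_scal;
  first [apply A | apply B].
Qed.

Lemma chain_has_lift n m v : rapid v ->
  has_lift (chain n m) p v (pairing p (chain_field p n m) v).
Proof.
intros Hv; revert m; induction n as [|n IH]; intros m; [now apply conserved_has_lift|].
simpl; rewrite pairing_twice_sum by (try easy; apply chain_field_rapid).
now apply has_lift_twice_sum.
Qed.

Lemma chain_field_step n m : telescoping p (chain_field p n m) /\
  opSum p (chain_field p n m) = chain_field p (S n) m.
Proof.
revert m; induction n as [|n IH]; intros m; [now apply hierarchy_field_step|].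
destruct (IH (m + 1)%Z) as [A1 A2], (IH (m - 1)%Z) as [B1 B2].
destruct (opSum_linear p 2 2 _ _ Hp A1 B1) as [D1 D2].
simpl chain_field at 1 2; split; [exact D1|].
rewrite D2, A2, B2; reflexivity.
Qed.

(** The constant rotations in R and the diagonal J combine into the scalar i. *)
Lemma opK_gradient_of Y : telescoping p Y -> opK p (gradient_of Y) = opJ (gradient_of (opSum p Y)).
Proof.
intros HY; destruct (opSum_linear p Ci 0 Y Y Hp HY HY) as [_ E].
apply functional_extensionality; intros k; unfold opK, opR.
replace (fun k => (- snd (opJ (gradient_of Y) k), fst (opJ (gradient_of Y) k))) with (lin_comb Ci 0 Y Y).
- change (cadd (opLplus p (lin_comb Ci 0 Y Y)) (opLminus p (lin_comb Ci 0 Y Y)))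
    with (opSum p (lin_comb Ci 0 Y Y)); rewrite E.
  unfold lin_comb, opJ, gradient_of; cbn [fst snd]; f_equal; ring.
- apply functional_extensionality; intros j; unfold lin_comb, opJ, gradient_of; cbn [fst snd];
    f_equal; ring.
Qed.

Lemma grad_chain n m : grad (chain n m) p = gradient_of (chain_field p n m).
Proof. apply grad_has_lift; [easy|]; intros v Hv; now apply chain_has_lift. Qed.

Lemma opK_grad_chain n m : opK p (grad (chain n m) p) = opJ (grad (chain (S n) m) p).
Proof.
rewrite !grad_chain; destruct (chain_field_step n m) as [A E].
now rewrite opK_gradient_of, E.
Qed.

End Chain.

Lemma chain_differentiable n m : differentiable (chain n m).
Proof.
intros p Hp; rewrite grad_chain by easy; split.
- pose proof (chain_field_rapid p Hp n m) as H; apply rapid_iff in H.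
  apply rapid_iff; split; apply rapidC_opp; apply H.
- intros v Hv; rewrite form_gradient_of; now apply has_lift_branch, chain_has_lift.
Qed.

Theorem theorem5 :
  exists H : nat -> functional,
    H 0%nat = H0 /\
    (forall n : nat, differentiable (H n)) /\
    forall (n : nat) (p : cseq), (1 <= n)%nat -> phase_space p ->
      forall k : Z,
        X n p k = opK p (grad (H (n - 1)%nat) p) k /\
        opK p (grad (H (n - 1)%nat) p) k = opJ (grad (H n) p) k.
Proof.
exists (fun n => chain n 0); split; [reflexivity|]; split; [intros n; apply chain_differentiable|].
intros n p Hn Hp.
assert (HX : forall n, X n p = opJ (grad (chain n 0) p)).
{ clear n Hn; induction n as [|n IH]; [reflexivity|].
  change (X (S n) p) with (opR p (X n p)); rewrite IH.
  now apply opK_grad_chain. }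
destruct n as [|n]; [lia|]; replace (S n - 1)%nat with n by lia.
intros k; rewrite HX, opK_grad_chain by easy; now split.
Qed.
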